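(* Let $d\geqslant 1$ and let $f\in L^1(\mathbb{R}^d)$ be real-valued and satisfy $f(x)\geqslant f\star f(x)$ for almost every $x\in\mathbb{R}^d$, and $\int_{\mathbb{R}^d} f(x)\,dx = \tfrac12$. Then $$\int_{\mathbb{R}^d} |x| f(x)\,dx = \infty.$$
   Context: For $f\in L^1(\mathbb{R}^d)$, $f\star f(x) = \int_{\mathbb{R}^d} f(x-y)f(y)\,dy$ denotes the convolution of $f$ with itself. Every real integrable $f$ with $f\geqslant f\star f$ almost everywhere is non-negative almost everywhere, so the integral $\int_{\mathbb{R}^d}|x|f(x)\,dx$ is well defined in $[0,\infty]$. *)

(* Defs.v *)
From HB Require Import structures.
From mathcomp Require Import all_boot all_order all_algebra.
From mathcomp Require Import all_classical all_reals all_analysis.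

Set Implicit Arguments.
Unset Strict Implicit.
Unset Printing Implicit Defensive.
Import Order.TTheory GRing.Theory Num.Theory.
Import numFieldNormedType.Exports.

Local Open Scope classical_set_scope.
Local Open Scope ring_scope.

Definition rV_coord (R : Type) (n : nat) (i : 'I_n) (x : 'rV[R]_n) : R :=
  x ord0 i.

(* The product sigma-algebra on R^n, generated by the coordinate maps; since R
   carries its Borel sigma-algebra, this is the Borel sigma-algebra of R^n. *)
Definition rV_measurable (R : realType) (n : nat) : set (set 'rV[R]_n) :=
  g_sigma_preimage (@rV_coord R n).

HB.instance Definition _ (R : realType) (n : nat) :=
  @isMeasurable.Build default_measure_display 'rV[R]_n (@rV_measurable R n)
    (@sigma_algebra0 _ _ _) (@sigma_algebraC _ _)
    (@sigma_algebra_bigcup _ _ _).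

(* (x, t) |-> (t, x_0, ..., x_(n-1)) *)
Definition rV_cons (R : realType) (n : nat) (p : 'rV[R]_n * R) : 'rV[R]_n.+1 :=
  \row_i oapp (p.1 ord0) p.2 (unlift ord0 i).

(* Lebesgue measure on R^n as an iterated product; it is the Dirac mass on the
   one-point space R^0. *)
Fixpoint lebesgue_rV (R : realType) (n : nat) : set 'rV[R]_n -> \bar R :=
  match n with
  | 0%N => dirac (0 : 'rV[R]_0)
  | m.+1 => pushforward (lebesgue_rV (n := m) \x lebesgue_measure)%E
              (@rV_cons R m)
  end.

Lemma measurable_rV_coord (R : realType) (n : nat) (i : 'I_n) :
  measurable_fun [set: 'rV[R]_n] (rV_coord i).
Proof.
move=> _ Y mY; rewrite setTI; apply: sub_sigma_algebra => /=.
rewrite -bigcup_seq/=; exists i => /=; first by rewrite mem_index_enum.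
by exists Y => //; rewrite setTI.
Qed.

Lemma measurable_fun_rVP (d : measure_display) (T : measurableType d)
    (R : realType) (n : nat) (f : T -> 'rV[R]_n) :
  measurable_fun [set: T] f <->
  forall i, measurable_fun [set: T] (rV_coord i \o f).
Proof.
split=> [mf i|mf].
  by apply: measurableT_comp => //; exact: measurable_rV_coord.
apply: (@measurability _ _ _ _ setT f
  (\big[setU/set0]_(i < n) preimage_set_system setT (@rV_coord R n i)
    measurable)) => //.
move=> _ [B + <-]; rewrite -bigcup_seq => -[i _ [A mA <-]].
by rewrite setTI setTI -comp_preimage -[X in measurable X]setTI; exact: mf.
Qed.

Lemma measurable_rV_cons (R : realType) (n : nat) :
  measurable_fun [set: 'rV[R]_n * R] (@rV_cons R n).
Proof.
apply/measurable_fun_rVP => i.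
case: (unliftP ord0 i) => [j ->|->].
  rewrite (_ : _ \o _ = rV_coord j \o fst); last first.
    by apply/funext => -[x t] /=; rewrite /rV_coord mxE liftK.
  by apply: measurableT_comp => //; exact: measurable_rV_coord.
rewrite (_ : _ \o _ = snd) //.
by apply/funext => -[x t] /=; rewrite /rV_coord mxE unlift_none.
Qed.

Definition rV_uncons (R : realType) (n : nat) (x : 'rV[R]_n.+1) : 'rV[R]_n * R :=
  (\row_i x ord0 (lift ord0 i), x ord0 ord0).

Lemma rV_consK (R : realType) (n : nat) :
  cancel (@rV_cons R n) (@rV_uncons R n).
Proof.
move=> [x t]; rewrite /rV_uncons /rV_cons mxE unlift_none /=; congr pair.
by apply/rowP => i; rewrite !mxE liftK.
Qed.

Lemma measurable_rV_uncons (R : realType) (n : nat) :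
  measurable_fun [set: 'rV[R]_n.+1] (@rV_uncons R n).
Proof.
apply/measurable_fun_pairP; split; last exact: (@measurable_rV_coord R n.+1 ord0).
apply/measurable_fun_rVP => i.
rewrite (_ : _ \o _ = rV_coord (lift ord0 i)).
  exact: measurable_rV_coord.
by apply/funext => x /=; rewrite /rV_coord mxE.
Qed.

Lemma lebesgue_rV_measure (R : realType) (n : nat) :
  exists2 mu : {measure set 'rV[R]_n -> \bar R},
    @lebesgue_rV R n = mu & sigma_finite setT mu.
Proof.
elim: n => [|n [mu IH mu_sf]] /=.
  exists (dirac (0 : 'rV[R]_0)) => //.
  exact: (sigma_finiteT (dirac (0 : 'rV[R]_0))).
rewrite IH.
have /sigma_finiteP[F [TF ndF Foo]] := mu_sf.
have /sigma_finiteP[G [TG ndG Goo]] := sigma_finiteT (@lebesgue_measure R).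
pose H i := F i `*` G i.
have TH : [set: 'rV[R]_n * R] = \bigcup_i H i.
  rewrite -setXTT TF TG predeqE => -[x y]; split.
    move=> [/= [k _ Fkx] [l _ Gly]]; exists (maxn k l) => //; split.
    - by move: x Fkx; exact/subsetPset/ndF/leq_maxl.
    - by move: y Gly; exact/subsetPset/ndG/leq_maxr.
  by move=> [k _ []/= ? ?]; split; exists k.
have FK i : (@rV_cons R n) @^-1` (@rV_uncons R n @^-1` H i) = H i.
  by apply/seteqP; split => x; rewrite /preimage /= rV_consK.
exists (measure_function_pushforward__canonical__measure_function_Measure
    (mu \x @lebesgue_measure R)%E (@measurable_rV_cons R n)) => //.
exists (fun i => @rV_uncons R n @^-1` H i).
  by rewrite -preimage_bigcup -TH preimage_setT.
move=> i; have [[mF Fi] [mG Gi]] := (Foo i, Goo i); split.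
  rewrite -[X in measurable X]setTI; apply: measurable_rV_uncons => //.
  exact: measurableX.
rewrite /= /pushforward FK product_measure1E// lte_mul_pinfty//.
by rewrite ge0_fin_numE.
Qed.

Lemma lebesgue_rV0 (R : realType) (n : nat) : @lebesgue_rV R n set0 = 0%E.
Proof.
by have [mu -> _] := lebesgue_rV_measure R n; exact: measure0.
Qed.

Lemma lebesgue_rV_ge0 (R : realType) (n : nat) (A : set 'rV[R]_n) :
  (0 <= lebesgue_rV A)%E.
Proof.
by have [mu -> _] := lebesgue_rV_measure R n; exact: measure_ge0.
Qed.

Lemma lebesgue_rV_semi_sigma_additive (R : realType) (n : nat) :
  semi_sigma_additive (@lebesgue_rV R n).
Proof.
have [mu -> _] := lebesgue_rV_measure R n.
exact: measure_semi_sigma_additive.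
Qed.

Lemma lebesgue_rV_sigma_finite (R : realType) (n : nat) :
  sigma_finite setT (@lebesgue_rV R n).
Proof.
by have [mu ->] := lebesgue_rV_measure R n.
Qed.

HB.instance Definition _ (R : realType) (n : nat) :=
  isMeasure.Build _ _ _ (@lebesgue_rV R n) (@lebesgue_rV0 R n)
    (@lebesgue_rV_ge0 R n) (@lebesgue_rV_semi_sigma_additive R n).
HB.instance Definition _ (R : realType) (n : nat) :=
  Measure_isSigmaFinite.Build _ _ _ (@lebesgue_rV R n)
    (@lebesgue_rV_sigma_finite R n).

Lemma lebesgue_rV_box (R : realType) (n : nat) (A : 'I_n -> set R) :
  (forall i, measurable (A i)) ->
  lebesgue_rV [set x : 'rV[R]_n | forall i, A i (x ord0 i)] =
  (\prod_(i < n) lebesgue_measure (A i))%E.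
Proof.
elim: n A => [|n IH] A mA.
  rewrite big_ord0 /= diracE mem_set //= => -[].
  by case.
pose B := [set x : 'rV[R]_n | forall i, A (lift ord0 i) (x ord0 i)].
have BE : rV_cons (n:=n) @^-1` [set x | forall i, A i (x ord0 i)] =
    B `*` A ord0.
  apply/seteqP; split => -[x t] /=.
    move=> h; split => /=; last by have := h ord0; rewrite mxE unlift_none.
    by move=> i; have := h (lift ord0 i); rewrite mxE liftK.
  move=> [xB tA] i; rewrite mxE.
  by case: (unliftP ord0 i) => [j ->|->] /=.
have mB : measurable B.
  rewrite (_ : B = \bigcap_i (rV_coord i @^-1` A (lift ord0 i))); last first.
    apply/seteqP; split => x /= h i; first by move=> _; exact: h.
    exact: (h i Logic.I).
  apply: fin_bigcap_measurable => // i _.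
  by rewrite -[X in measurable X]setTI; exact: measurable_rV_coord.
rewrite big_ord_recl /= /pushforward BE.
rewrite (product_measure1E (lebesgue_rV (R:=R) (n:=n)) lebesgue_measure mB (mA ord0)).
rewrite muleC; congr (_ * _)%E; exact: IH.
Qed.

(* The norm `|x| provided by the library on 'rV[R]_n is the sup norm. *)
Definition eucl_norm (R : realType) (n : nat) (x : 'rV[R]_n) : R :=
  Num.sqrt (\sum_(i < n) x ord0 i ^+ 2).

(* For f, g integrable the integrand is integrable for almost every x; at the
   remaining points the value is meaningless. *)
Definition convolution (R : realType) (n : nat) (f g : 'rV[R]_n -> R)
    (x : 'rV[R]_n) : R :=
  \int[@lebesgue_rV R n]_y (f (x - y) * g y).

(* Main.v *)
(* Put u = f - f * f (convolution), so that u >= 0 has mass 1/4. Iterating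
   F |-> u + F * F from 0 gives an increasing sequence whose limit F >= 0 has
   mass 1/2 and satisfies F = u + F * F. With ^ for the Fourier transform,
   f^ - f^ ^2 = F^ - F^ ^2, so at each frequency k either f^ = F^ or
   f^ = 1 - F^. For k <> 0 one has Re F^(k) < 1/2, so Re f^ never equals 1/2
   away from 0; being continuous along the ray through k and small somewhere on
   it by the Riemann-Lebesgue lemma, it stays below 1/2, which excludes the
   second root. Hence f = F almost everywhere and f >= 0.
   If |x| f were integrable, C(k) = \int f (1 - cos (k.x)) would be o(|k|). The
   real part of u^ = f^ - f^ ^2 is \int u (1 - cos (k.x)) = C(k)^2 - S(k)^2 with
   S(k) = \int f sin (k.x), hence 4^m \int u (1 - cos (2^-m k.x)) -> 0. But
   1 - cos (2 t) <= 4 (1 - cos t) bounds this below by the positive number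
   \int u (1 - cos (k.x)). *)
Require Import Defs.
From HB Require Import structures.
From mathcomp Require Import all_boot all_order all_algebra.
From mathcomp Require Import all_classical all_reals all_analysis.
From mathcomp Require Import measurable_realfun ring lra.

Import Order.TTheory GRing.Theory Num.Theory.
Import numFieldNormedType.Exports.

Local Open Scope classical_set_scope.
Local Open Scope ring_scope.
Set Implicit Arguments.
Unset Strict Implicit.
Unset Printing Implicit Defensive.

(** * Translation invariance *)

(** The pushforward of Lebesgue measure under t |-> t + c gives every half-open interval its length,
    and this determines a measure on the line. *)
Lemma lebesgue_measure_translation (R : realType) (c : R) (A : set R) :
  measurable A -> lebesgue_measure ((fun t : R => t + c) @^-1` A) =
  lebesgue_measure A.
Proof.
have mc : measurable_fun [set: measurableTypeR R]
    ((fun t : R => t + c) : measurableTypeR R -> measurableTypeR R).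
  exact: measurable_funD.
pose nu := measure_function_pushforward__canonical__measure_function_Measure
  (@lebesgue_measure R) mc.
move=> mA; symmetry.
apply: (@lebesgue_measure_unique R nu) => //= X [[a b] _ <-].
rewrite /nu /= /pushforward.
rewrite (_ : _ @^-1` _ = `]a - c, b - c]%classic); last first.
  by apply/seteqP; split => t /=; rewrite !in_itv /= ltrBlDr lerBrDr.
rewrite !lebesgue_measure_itv /= !lte_fin ltrBlDr subrK.
by case: ifP => // _; rewrite -!EFinB opprB addrA subrK.
Qed.

Lemma measurable_rV_translation (R : realType) (n : nat) (v : 'rV[R]_n) :
  measurable_fun setT (fun x : 'rV[R]_n => x + v).
Proof.
apply/measurable_fun_rVP => i.
rewrite (_ : _ \o _ = (fun x => rV_coord i x + v ord0 i)); last first.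
  by apply/funext => x; rewrite /rV_coord /= mxE.
by apply: measurable_funD => //; exact: measurable_rV_coord.
Qed.

(** Change of variables along [rV_cons], then Tonelli. Splitting off the first coordinate in this
    way drives the inductions on the dimension. *)
Lemma ge0_integral_lebesgue_rVS (R : realType) (n : nat)
    (g : 'rV[R]_n.+1 -> \bar R) :
  measurable_fun setT g -> (forall x, 0 <= g x)%E ->
  (\int[@lebesgue_rV R n.+1]_x g x =
   \int[@lebesgue_rV R n]_x \int[@lebesgue_measure R]_t g (rV_cons (x, t)))%E.
Proof.
move=> mg g0.
pose m := (@lebesgue_rV R n \x @lebesgue_measure R)%E.
transitivity (\int[m]_z g (rV_cons z))%E.
  have := @ge0_integral_pushforward _ _ ('rV[R]_n * measurableTypeR R)%type _ R
    _ (@measurable_rV_cons R n) m _ _ measurableT mg (fun x _ => g0 x).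
  by rewrite preimage_setT.
rewrite /m.
rewrite fubini_tonelli1 //.
apply: measurableT_comp => //.
exact: measurable_rV_cons.
Qed.

Lemma ge0_integral_lebesgue_translation (R : realType) (c : R)
    (g : R -> \bar R) :
  measurable_fun setT g -> (forall x, 0 <= g x)%E ->
  (\int[@lebesgue_measure R]_t g (t + c)%R = \int[@lebesgue_measure R]_t g t)%E.
Proof.
move=> mg g0.
have mc : measurable_fun [set: measurableTypeR R]
    ((fun t : R => t + c) : measurableTypeR R -> measurableTypeR R).
  exact: measurable_funD.
have := ge0_integral_pushforward mc (@lebesgue_measure R) measurableT mg
  (fun y _ => g0 y).
rewrite preimage_setT /= => <-.
by apply: eq_measure_integral => A mA _ /=; exact: lebesgue_measure_translation.
Qed.

(** Induction on the dimension: a translation acts separately on the first coordinate and on the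
    remaining ones, so after Tonelli the inner integral is the one-dimensional case and the outer
    one the induction hypothesis. *)
Lemma ge0_integral_rV_translation (R : realType) (n : nat) (v : 'rV[R]_n)
    (g : 'rV[R]_n -> \bar R) :
  measurable_fun setT g -> (forall x, 0 <= g x)%E ->
  (\int[@lebesgue_rV R n]_x g (x + v)%R = \int[@lebesgue_rV R n]_x g x)%E.
Proof.
elim: n v g => [|n IH] v g mg g0.
  by apply: eq_integral => x _; congr g; apply/rowP => -[].
pose w := (rV_uncons v).1; pose c := (rV_uncons v).2.
have consD x t : rV_cons (x, t) + v = rV_cons (x + w, t + c).
  apply/rowP => i; rewrite !mxE; case: (unliftP ord0 i) => [j ->|->] //=.
  by rewrite !mxE.
have mgc : measurable_fun setT (g \o @rV_cons R n).
  by apply: measurableT_comp => //; exact: measurable_rV_cons.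
rewrite ge0_integral_lebesgue_rVS //; last first.
  by apply: measurableT_comp => //; exact: measurable_rV_translation.
rewrite ge0_integral_lebesgue_rVS //.
pose G x := (\int[@lebesgue_measure R]_t g (rV_cons (x, t)))%E.
rewrite -[RHS](IH w G); last 2 first.
- apply: (@measurable_fun_fubini_tonelli_F _ _ _ (measurableTypeR R) R
    (@lebesgue_measure R) (g \o @rV_cons R n)) => // z; exact: g0.
- by move=> x; apply: integral_ge0.
apply: eq_integral => x _; rewrite /G.
under eq_integral do rewrite consD.
have mh : measurable_fun setT (fun t : R => g (rV_cons (x + w, t))).
  exact: (measurableT_comp mgc (measurable_pair1 (x + w))).
exact: (ge0_integral_lebesgue_translation c mh).
Qed.

(** * Convolution and Fubini *)

Lemma integrable_mul_bounded d (T : measurableType d) (R : realType)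
    (mu : {measure set T -> \bar R}) (g p : T -> R) (M : R) :
  mu.-integrable setT (EFin \o g) -> measurable_fun setT p ->
  (forall x, `|p x| <= M) ->
  mu.-integrable setT (EFin \o (fun x => g x * p x)).
Proof.
move=> ig mp pM.
have := @integrableMl _ _ _ mu _ measurableT (EFin \o g) p ig mp.
apply; exists M; split => [|N MN x _]; first exact: num_real.
exact: le_trans (pM x) (ltW MN).
Qed.

Lemma ae_eq_Rintegral d (T : measurableType d) (R : realType)
    (mu : {measure set T -> \bar R}) (g h : T -> R) :
  measurable_fun setT g -> measurable_fun setT h ->
  {ae mu, forall x, g x = h x} ->
  \int[mu]_x g x = \int[mu]_x h x.
Proof.
move=> mg mh gh; congr fine; apply: ae_eq_integral => //.
- exact/measurable_EFinP.
- exact/measurable_EFinP.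
- by apply: filterS gh => x /= -> _.
Qed.

Lemma integral_rV_translation (R : realType) (n : nat) (v : 'rV[R]_n)
    (g : 'rV[R]_n -> \bar R) :
  measurable_fun setT g ->
  (\int[@lebesgue_rV R n]_x g (x + v)%R = \int[@lebesgue_rV R n]_x g x)%E.
Proof.
move=> mg; rewrite integralE [RHS]integralE.
congr (_ - _)%E.
- rewrite -(@ge0_integral_rV_translation _ _ v g^\+%E) //; last exact: measurable_funepos.
  by apply: eq_integral => x _; rewrite funeposE funeposE.
- rewrite -(@ge0_integral_rV_translation _ _ v g^\-%E) //; last exact: measurable_funeneg.
  by apply: eq_integral => x _; rewrite funenegE funenegE.
Qed.

Lemma measurable_rV_sub (R : realType) (n : nat) :
  measurable_fun setT (fun z : 'rV[R]_n * 'rV[R]_n => z.1 - z.2).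
Proof.
apply/measurable_fun_rVP => i.
rewrite (_ : _ \o _ = (rV_coord i \o fst) \- (rV_coord i \o snd)); last first.
  by apply/funext => x; rewrite /rV_coord /= !mxE.
by apply: measurable_funB; apply: measurableT_comp => //;
  exact: measurable_rV_coord.
Qed.

Lemma measurable_conv_kernel (R : realType) (n : nat) (G : 'rV[R]_n -> \bar R) :
  measurable_fun setT G ->
  measurable_fun setT
    (fun z : 'rV[R]_n * 'rV[R]_n => G (z.1 - z.2)%R * G z.2)%E.
Proof.
move=> mG; apply: emeasurable_funM; apply: measurableT_comp => //.
exact: measurable_rV_sub.
Qed.

(** Self-convolution with values in [0, +oo] for [G] non-negative: it makes sense at every point and
    is suited to Tonelli and to monotone limits. *)
Definition econv (R : realType) (n : nat) (G : 'rV[R]_n -> \bar R)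
    (x : 'rV[R]_n) : \bar R :=
  (\int[@lebesgue_rV R n]_y (G (x - y)%R * G y))%E.

Lemma econv_ge0 (R : realType) (n : nat) (G : 'rV[R]_n -> \bar R) x :
  (forall x, 0 <= G x)%E -> (0 <= econv G x)%E.
Proof. by move=> G0; apply: integral_ge0 => y _; exact: mule_ge0. Qed.

Lemma measurable_econv (R : realType) (n : nat) (G : 'rV[R]_n -> \bar R) :
  measurable_fun setT G -> (forall x, 0 <= G x)%E ->
  measurable_fun setT (econv G).
Proof.
move=> mG G0.
apply: (@measurable_fun_fubini_tonelli_F _ _ _ _ R (@lebesgue_rV R n)
  (fun z : 'rV[R]_n * 'rV[R]_n => G (z.1 - z.2)%R * G z.2)%E).
- exact: measurable_conv_kernel.
- by move=> z; exact: mule_ge0.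
Qed.

(** By Tonelli the integral in x can be taken first; for fixed y it is that of a translate of [G],
    hence the whole mass of [G] times [G y]. *)
Lemma integral_econv (R : realType) (n : nat) (G : 'rV[R]_n -> \bar R) :
  measurable_fun setT G -> (forall x, 0 <= G x)%E ->
  (\int[@lebesgue_rV R n]_x econv G x =
   (\int[@lebesgue_rV R n]_x G x) * (\int[@lebesgue_rV R n]_x G x))%E.
Proof.
move=> mG G0.
have I0 : (0 <= \int[@lebesgue_rV R n]_x G x)%E by exact: integral_ge0.
rewrite (@fubini_tonelli _ _ _ _ R (@lebesgue_rV R n) (@lebesgue_rV R n)
  (fun z : 'rV[R]_n * 'rV[R]_n => G (z.1 - z.2)%R * G z.2)%E) /=.
- rewrite -[RHS]ge0_integralZl //.
  apply: eq_integral => y _.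
  rewrite ge0_integralZr //.
    by rewrite (integral_rV_translation (- y) mG).
  exact: (measurableT_comp mG (measurable_rV_translation (- y))).
- exact: measurable_conv_kernel.
- by move=> z; exact: mule_ge0.
Qed.

Section convolution.
Variables (R : realType) (n : nat) (g : 'rV[R]_n -> R).
Local Notation mu := (@lebesgue_rV R n).
Hypothesis ig : mu.-integrable setT (EFin \o g).

Let mg : measurable_fun setT g.
Proof. by apply/measurable_EFinP; exact: measurable_int ig. Qed.

(** By [integral_econv] applied to |g|, the kernel has L1 norm equal to the square of that of
    [g]. *)
Lemma integrable_conv_kernel :
  (mu \x mu)%E.-integrable setT
    (EFin \o (fun z : 'rV[R]_n * 'rV[R]_n => g (z.1 - z.2) * g z.2)).
Proof.
have mk : measurable_fun setT
    (EFin \o (fun z : 'rV[R]_n * 'rV[R]_n => g (z.1 - z.2) * g z.2)).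
  exact: (measurable_conv_kernel (measurable_int mu ig)).
apply/(integrable12ltyP mu mu mk).
pose G := (abse \o (EFin \o g))%E.
have mG : measurable_fun setT G.
  by apply: measurableT_comp => //; exact/measurable_EFinP.
have G0 x : (0 <= G x)%E by exact: abse_ge0.
have IG : (\int[mu]_x G x < +oo)%E by case/integrableP : ig.
have IG0 : (0 <= \int[mu]_x G x)%E by exact: integral_ge0.
have := integral_econv mG G0.
rewrite /econv.
under eq_integral do under eq_integral do rewrite /G /= -EFinM -normrM.
move=> ->.
have /fineK <- : (\int[mu]_x G x)%E \is a fin_num by rewrite ge0_fin_numE.
by rewrite -EFinM ltry.
Qed.

Lemma measurable_convolution : measurable_fun setT (convolution g g).
Proof.
apply: measurableT_comp.
  exact: fine_measurable.
exact: (measurable_fubini_F integrable_conv_kernel).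
Qed.

(** [convolution] is the [fine] of an integral, and [fine] sends infinite values to 0. The two sides
    agree wherever the section of the kernel is integrable, which is almost everywhere by Fubini. *)
Lemma EFin_convolution :
  {ae mu, forall x, (convolution g g x)%:E =
    \int[mu]_y (g (x - y) * g y)%:E}%E.
Proof.
have := ae_integrable1 integrable_conv_kernel.
apply: filterS => x /= ix.
by rewrite /convolution /Rintegral fineK //; exact: integrable_fin_num.
Qed.

Lemma integrable_convolution : mu.-integrable setT (EFin \o convolution g g).
Proof.
have iF := integrable_fubini_F integrable_conv_kernel.
have mF := measurable_int mu iF.
have /integrableP[_ Foo] := iF.
apply/integrableP; split.
  by apply/measurable_EFinP; exact: measurable_convolution.
apply: le_lt_trans Foo; apply: ae_ge0_le_integral => //.
- by apply: measurableT_comp => //; apply/measurable_EFinP; exact: measurable_convolution.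
- exact: measurableT_comp.
- apply: filterS EFin_convolution => x cx _.
  by rewrite [X in (`|X| <= _)%E]cx.
Qed.

(** Fubini for g(x - y) g(y) p(x), then the substitution x |-> x + y in the inner integral. With [p]
    a cosine or a sine this becomes the convolution theorem. *)
Lemma integral_convolution_mul (p : 'rV[R]_n -> R) (M : R) :
  measurable_fun setT p -> (forall x, `|p x| <= M) ->
  \int[mu]_x (convolution g g x * p x) =
  \int[mu]_y (g y * \int[mu]_x (g x * p (x + y))).
Proof.
move=> mp pM.
pose K := fun z : 'rV[R]_n * 'rV[R]_n => g (z.1 - z.2) * g z.2 * p z.1.
have iK : (mu \x mu)%E.-integrable setT (EFin \o K).
  apply: (integrable_mul_bounded (M := M)) => //.
  - exact: integrable_conv_kernel.
  - exact: measurableT_comp.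
transitivity (fine (\int[mu]_x \int[mu]_y (EFin \o K) (x, y))%E).
  congr fine; apply: ae_eq_integral => //.
  - apply/measurable_EFinP; apply: measurable_funM => //.
    exact: measurable_convolution.
  - exact: (measurable_fubini_F iK).
  - apply: filterS2 EFin_convolution (ae_integrable1 integrable_conv_kernel).
    move=> x /= cx ix _.
    rewrite EFinM cx /K /= -integralZr //.
rewrite (Fubini iK) /=; congr fine; apply: eq_integral => y _.
pose h := fun x => g x * g y * p (x + y).
transitivity (\int[mu]_x (EFin \o h) (x - y)%R)%E.
  by apply: eq_integral => x _; rewrite /K /h /= subrK.
have mh : measurable_fun setT (fun x => g x * p (x + y)).
  apply: measurable_funM => //; apply: measurableT_comp => //.
  exact: measurable_rV_translation.
have ih : mu.-integrable setT (EFin \o (fun x => g x * p (x + y))).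
  apply: (integrable_mul_bounded (M := M)) => //.
  apply: measurableT_comp => //.
  exact: measurable_rV_translation.
rewrite integral_rV_translation.
  rewrite EFinM /Rintegral fineK; last exact: integrable_fin_num.
  rewrite -integralZl //; apply: eq_integral => x _ /=.
  by rewrite /h -EFinM; congr EFin; ring.
apply/measurable_EFinP.
rewrite (_ : h = fun x => g y * (g x * p (x + y))).
  exact: measurable_funM.
by apply/funext => x; rewrite /h; ring.
Qed.

End convolution.

(** * Sine and cosine transforms *)

Definition rV_dot (R : realType) (n : nat) (k x : 'rV[R]_n) : R :=
  \sum_(i < n) k ord0 i * x ord0 i.

Lemma rV_dotDr (R : realType) (n : nat) (k x y : 'rV[R]_n) :
  rV_dot k (x + y) = rV_dot k x + rV_dot k y.
Proof. by rewrite -big_split; apply: eq_bigr => i _; rewrite mxE mulrDr. Qed.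

Lemma rV_dotDl (R : realType) (n : nat) (k l x : 'rV[R]_n) :
  rV_dot (k + l) x = rV_dot k x + rV_dot l x.
Proof. by rewrite -big_split; apply: eq_bigr => i _; rewrite mxE mulrDl. Qed.

Lemma rV_dotZl (R : realType) (n : nat) (a : R) (k x : 'rV[R]_n) :
  rV_dot (a *: k) x = a * rV_dot k x.
Proof. by rewrite mulr_sumr; apply: eq_bigr => i _; rewrite mxE mulrA. Qed.

Lemma rV_dot0l (R : realType) (n : nat) (x : 'rV[R]_n) : rV_dot 0 x = 0.
Proof. by rewrite -(scale0r 0) rV_dotZl mul0r. Qed.

Lemma rV_dotNl (R : realType) (n : nat) (k x : 'rV[R]_n) :
  rV_dot (- k) x = - rV_dot k x.
Proof. by rewrite -scaleN1r rV_dotZl mulN1r. Qed.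

Lemma rV_dot_delta (R : realType) (n : nat) (i : 'I_n) (x : 'rV[R]_n) :
  rV_dot (delta_mx ord0 i) x = x ord0 i.
Proof.
rewrite /rV_dot (bigD1 i) //= mxE !eqxx mul1r big1 ?addr0 // => j ji.
by rewrite mxE (negbTE ji) andbF mul0r.
Qed.

Lemma rV_dot_cons (R : realType) (n : nat) (k : 'rV[R]_n.+1) x t :
  rV_dot k (rV_cons (x, t)) = rV_dot (rV_uncons k).1 x + k ord0 ord0 * t.
Proof.
rewrite /rV_dot big_ord_recl addrC; congr (_ + _).
  by apply: eq_bigr => i _; rewrite !mxE liftK.
by rewrite mxE unlift_none.
Qed.

Lemma measurable_rV_dot (R : realType) (n : nat) (k : 'rV[R]_n) :
  measurable_fun setT (rV_dot k).
Proof.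
apply: measurable_sum => i; apply: measurable_funM => //.
exact: measurable_rV_coord.
Qed.

Lemma measurable_cos_dot (R : realType) (n : nat) (k : 'rV[R]_n) (a : R) :
  measurable_fun setT (fun x => cos (rV_dot k x + a)).
Proof.
apply: (@measurableT_comp _ _ _ _ _ _ cos).
  by apply: continuous_measurable_fun; exact: continuous_cos.
by apply: measurable_funD => //; exact: measurable_rV_dot.
Qed.

Lemma measurable_sin_dot (R : realType) (n : nat) (k : 'rV[R]_n) (a : R) :
  measurable_fun setT (fun x => sin (rV_dot k x + a)).
Proof.
apply: (@measurableT_comp _ _ _ _ _ _ sin).
  by apply: continuous_measurable_fun; exact: continuous_sin.
by apply: measurable_funD => //; exact: measurable_rV_dot.
Qed.

(** [fcos] and [fsin] are the real and imaginary parts of the Fourier transform g^(k), the integral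
    of g(x) e^(i k.x). *)
Definition fcos (R : realType) (n : nat) (g : 'rV[R]_n -> R) (k : 'rV[R]_n) : R :=
  \int[@lebesgue_rV R n]_x (g x * cos (rV_dot k x)).

Definition fsin (R : realType) (n : nat) (g : 'rV[R]_n -> R) (k : 'rV[R]_n) : R :=
  \int[@lebesgue_rV R n]_x (g x * sin (rV_dot k x)).

Section trigonometric_transform.
Variables (R : realType) (n : nat).
Local Notation mu := (@lebesgue_rV R n).

Lemma measurable_cosdot (k : 'rV[R]_n) :
  measurable_fun setT (fun x => cos (rV_dot k x)).
Proof. by under eq_fun do rewrite -[rV_dot k _]addr0; exact: measurable_cos_dot. Qed.

Lemma measurable_sindot (k : 'rV[R]_n) :
  measurable_fun setT (fun x => sin (rV_dot k x)).
Proof. by under eq_fun do rewrite -[rV_dot k _]addr0; exact: measurable_sin_dot. Qed.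

Lemma integrable_mulcos (g : 'rV[R]_n -> R) k :
  mu.-integrable setT (EFin \o g) ->
  mu.-integrable setT (EFin \o (fun x => g x * cos (rV_dot k x))).
Proof.
move=> ig; apply: (integrable_mul_bounded (M := 1)) => //.
- exact: measurable_cosdot.
- by move=> x; exact: cos_max.
Qed.

Lemma integrable_mulsin (g : 'rV[R]_n -> R) k :
  mu.-integrable setT (EFin \o g) ->
  mu.-integrable setT (EFin \o (fun x => g x * sin (rV_dot k x))).
Proof.
move=> ig; apply: (integrable_mul_bounded (M := 1)) => //.
- exact: measurable_sindot.
- by move=> x; exact: sin_max.
Qed.

Lemma fcosB (g h : 'rV[R]_n -> R) k :
  mu.-integrable setT (EFin \o g) -> mu.-integrable setT (EFin \o h) ->
  fcos (fun x => g x - h x) k = fcos g k - fcos h k.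
Proof.
move=> ig ih; rewrite /fcos -RintegralB //; try exact: integrable_mulcos.
by apply: eq_Rintegral => x _; rewrite mulrBl.
Qed.

Lemma fsinB (g h : 'rV[R]_n -> R) k :
  mu.-integrable setT (EFin \o g) -> mu.-integrable setT (EFin \o h) ->
  fsin (fun x => g x - h x) k = fsin g k - fsin h k.
Proof.
move=> ig ih; rewrite /fsin -RintegralB //; try exact: integrable_mulsin.
by apply: eq_Rintegral => x _; rewrite mulrBl.
Qed.

Lemma fcos0 (g : 'rV[R]_n -> R) : fcos g 0 = \int[mu]_x g x.
Proof. by apply: eq_Rintegral => x _; rewrite rV_dot0l cos0 mulr1. Qed.

Lemma fsin0 (g : 'rV[R]_n -> R) : fsin g 0 = 0.
Proof.
rewrite /fsin; under eq_Rintegral do rewrite rV_dot0l sin0 mulr0.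
by rewrite Rintegral_cst // mul0r.
Qed.

Lemma Rintegral_mulcosD (g : 'rV[R]_n -> R) k a :
  mu.-integrable setT (EFin \o g) ->
  \int[mu]_x (g x * cos (rV_dot k x + a)) = cos a * fcos g k - sin a * fsin g k.
Proof.
move=> ig; rewrite /fcos /fsin -!RintegralZl //;
  try solve [exact: integrable_mulcos | exact: integrable_mulsin].
rewrite -RintegralB //.
- by apply: eq_Rintegral => x _; rewrite cosD; ring.
- by have := integrableZl measurableT (cos a) (integrable_mulcos k ig).
- by have := integrableZl measurableT (sin a) (integrable_mulsin k ig).
Qed.

Lemma Rintegral_mulsinD (g : 'rV[R]_n -> R) k a :
  mu.-integrable setT (EFin \o g) ->
  \int[mu]_x (g x * sin (rV_dot k x + a)) = cos a * fsin g k + sin a * fcos g k.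
Proof.
move=> ig; rewrite /fcos /fsin -!RintegralZl //;
  try solve [exact: integrable_mulcos | exact: integrable_mulsin].
rewrite -RintegralD //.
- by apply: eq_Rintegral => x _; rewrite sinD; ring.
- by have := integrableZl measurableT (cos a) (integrable_mulsin k ig).
- by have := integrableZl measurableT (sin a) (integrable_mulcos k ig).
Qed.

(** Real part of (g * g)^ = (g^)^2: the addition formula separates the variables in
    [integral_convolution_mul]. *)
Lemma fcos_convolution (g : 'rV[R]_n -> R) k :
  mu.-integrable setT (EFin \o g) ->
  fcos (convolution g g) k = fcos g k ^+ 2 - fsin g k ^+ 2.
Proof.
move=> ig; rewrite /fcos (integral_convolution_mul ig (M := 1)); last 2 first.
- exact: measurable_cosdot.
- by move=> x; exact: cos_max.
transitivity (\int[mu]_y (fcos g k * (g y * cos (rV_dot k y)) -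
                          fsin g k * (g y * sin (rV_dot k y)))).
  apply: eq_Rintegral => y _; under eq_Rintegral do rewrite rV_dotDr.
  by rewrite Rintegral_mulcosD //; ring.
rewrite RintegralB //.
- rewrite !RintegralZl //; try solve [exact: integrable_mulcos | exact: integrable_mulsin].
- by have := integrableZl measurableT (fcos g k) (integrable_mulcos k ig).
- by have := integrableZl measurableT (fsin g k) (integrable_mulsin k ig).
Qed.

(** Imaginary part of the same identity. *)
Lemma fsin_convolution (g : 'rV[R]_n -> R) k :
  mu.-integrable setT (EFin \o g) ->
  fsin (convolution g g) k = 2 * (fcos g k * fsin g k).
Proof.
move=> ig; rewrite /fsin (integral_convolution_mul ig (M := 1)); last 2 first.
- exact: measurable_sindot.
- by move=> x; exact: sin_max.
transitivity (\int[mu]_y (fsin g k * (g y * cos (rV_dot k y)) +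
                          fcos g k * (g y * sin (rV_dot k y)))).
  apply: eq_Rintegral => y _; under eq_Rintegral do rewrite rV_dotDr.
  by rewrite Rintegral_mulsinD //; ring.
rewrite RintegralD //.
- rewrite !RintegralZl //; try solve [exact: integrable_mulcos | exact: integrable_mulsin].
  rewrite -/(fcos g k) -/(fsin g k); ring.
- by have := integrableZl measurableT (fsin g k) (integrable_mulcos k ig).
- by have := integrableZl measurableT (fcos g k) (integrable_mulsin k ig).
Qed.

End trigonometric_transform.

(** * Null sets and almost everywhere arguments *)

Lemma Rintegral_dominated_cvg d (T : measurableType d) (R : realType)
    (mu : {measure set T -> \bar R}) (g_ : nat -> T -> R) (g h : T -> R) :
  (forall n, measurable_fun setT (g_ n)) -> measurable_fun setT g ->
  {ae mu, forall x, g_ n x @[n --> \oo] --> g x} ->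
  mu.-integrable setT (EFin \o h) ->
  {ae mu, forall x n, `|g_ n x| <= h x} ->
  \int[mu]_x g_ n x @[n --> \oo] --> \int[mu]_x g x.
Proof.
move=> mg_ mg g_g ih g_h.
have EFin_cvg : {ae mu, forall x,
    setT x -> (g_ n x)%:E @[n --> \oo] --> (g x)%:E}.
  by apply: filterS g_g => x gx _; apply/cvg_EFin => //; exact: nearW.
have EFin_le : {ae mu, forall x n, setT x -> (`|(g_ n x)%:E| <= (h x)%:E)%E}.
  by apply: filterS g_h => x gx n _; rewrite lee_fin.
have [ig _] := dominated_convergence measurableT
  (fun n => (measurable_EFinP setT (g_ n)).2 (mg_ n))
  ((measurable_EFinP setT g).2 mg) EFin_cvg ih EFin_le.
rewrite -[X in _ --> X -> _]fineK; last exact: integrable_fin_num.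
exact: fine_cvg.
Qed.

Lemma ge0_Rintegral_eq0 d (T : measurableType d) (R : realType)
    (mu : {measure set T -> \bar R}) (g : T -> R) :
  mu.-integrable setT (EFin \o g) -> {ae mu, forall x, 0 <= g x} ->
  \int[mu]_x g x = 0 -> {ae mu, forall x, g x = 0}.
Proof.
move=> ig g0 Ig.
have mg := measurable_int mu ig.
have : (\int[mu]_x `|(EFin \o g) x| = 0)%E.
  rewrite -[RHS]/(0%:E) -Ig /Rintegral fineK; last exact: integrable_fin_num.
  apply: ae_eq_integral => //; first exact: measurableT_comp.
  by apply: filterS g0 => x /= gx _; rewrite ger0_norm.
move/(ae_eq_integral_abs mu measurableT mg); apply: filterS => x /= /(_ Logic.I).
by case.
Qed.

(** Subtracting floor(x / pi) * pi moves x into [0, pi), where the sine vanishes only at 0. *)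
Lemma sin_eq0_int (R : realType) (x : R) :
  sin x = 0 -> exists z : int, x = z%:~R * pi.
Proof.
move=> sx.
have sinnpi (m : nat) : sin (m%:R * pi : R) = 0.
  elim: m => [|m IH]; first by rewrite mul0r sin0.
  by rewrite -addn1 natrD mulrDl mul1r sinD IH sinpi mul0r mulr0 addr0.
have sinzpi (z : int) : sin (z%:~R * pi : R) = 0.
  case: z => m; first exact: sinnpi.
  by rewrite NegzE mulrNz mulNr sinN sinnpi oppr0.
pose z := Num.floor (x / pi).
exists z.
have /andP[zx xz] : z%:~R <= x / pi < (z + 1)%:~R by exact: floor_itv.
have pi0 : 0 < pi :> R by exact: pi_gt0.
have r0 : 0 <= x - z%:~R * pi by rewrite subr_ge0 -ler_pdivlMr.
have rpi : x - z%:~R * pi < pi.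
  by rewrite ltrBlDr -[X in X + _]mul1r -mulrDl addrC -ltr_pdivrMr// -intrD1.
have sr : sin (x - z%:~R * pi) = 0.
  by rewrite sinB sx sinzpi mul0r mulr0 subrr.
apply/eqP; rewrite -subr_eq0; apply/negP => /negP rn0.
have : 0 < sin (x - z%:~R * pi).
  by apply: sin_gt0_pi; rewrite rpi andbT lt_neqAle eq_sym rn0.
by rewrite sr ltxx.
Qed.

Lemma countable_sin_affine_eq0 (R : realType) (a b : R) : a != 0 ->
  countable [set t : R | sin (a * t + b) = 0].
Proof.
move=> a0.
apply: (@sub_countable _ _ _ (\bigcup_(z in [set: int]) [set (z%:~R * pi - b) / a])).
  apply: subset_card_le => t /= /sin_eq0_int[z tz]; exists z => //=.
  by rewrite -tz addrK mulrC mulKf.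
by apply: bigcup_countable => // z _; exact: countable1.
Qed.

Section sin_zeros.
Variable R : realType.

Let sin0_set n (k : 'rV[R]_n) b := [set x : 'rV[R]_n | sin (rV_dot k x + b) = 0].

Let measurable_sin0_set n (k : 'rV[R]_n) b : measurable (sin0_set k b).
Proof.
rewrite -[X in measurable X]setTI.
exact: (measurable_sin_dot k b measurableT (measurable_set1 0)).
Qed.

(** Induction on the dimension. If the first coordinate of [k] is 0, the condition concerns the
    other coordinates only and the induction hypothesis applies to each section. Otherwise, with the
    other coordinates fixed, the section is the zero set of the sine of a non-constant affine
    function, which is countable and hence null. *)
Lemma lebesgue_rV_sin_eq0 n (k : 'rV[R]_n) b : k != 0 ->
  lebesgue_rV [set x : 'rV[R]_n | sin (rV_dot k x + b) = 0] = 0%E.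
Proof.
elim: n k b => [|n IH] k b k0.
  by move: k0; rewrite (_ : k = 0) ?eqxx //; apply/rowP => -[].
have mA := measurable_sin0_set k b.
change (lebesgue_rV (sin0_set k b) = 0%E).
rewrite -[sin0_set k b]setIT -(integral_indic _ measurableT mA).
rewrite ge0_integral_lebesgue_rVS //; last first.
  by apply/measurable_EFinP; exact: measurable_indic.
pose k' := (rV_uncons k).1.
have sec x t : \1_(sin0_set k b) (rV_cons (x, t)) =
    \1_(sin0_set k' (k ord0 ord0 * t + b)) x :> R.
  rewrite !indicE; congr (nat_of_bool _)%:R; apply/idP/idP; rewrite !inE /sin0_set /=;
  by rewrite rV_dot_cons -addrA.
have [k00|k00] := eqVneq (k ord0 ord0) 0.
- have k'0 : k' != 0.
    apply: contra k0 => /eqP k'0; apply/eqP/rowP => i; rewrite mxE.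
    case: (unliftP ord0 i) => [j ->|->] //.
    by move/rowP/(_ j): k'0; rewrite !mxE.
  rewrite (_ : (fun x => _) = fun x =>
    (\int[@lebesgue_measure R]_t (\1_(sin0_set k' b) x)%:E)%E); last first.
    by apply/funext => x; apply: eq_integral => t _; rewrite sec k00 mul0r add0r.
  have mI : measurable_fun setT (\1_(sin0_set k' b) : _ -> R).
    by apply: measurable_indic; exact: measurable_sin0_set.
  rewrite (@fubini_tonelli _ _ _ (measurableTypeR R) R (@lebesgue_rV R n) (@lebesgue_measure R)
    (fun z => (\1_(sin0_set k' b) z.1)%:E)) //=; last first.
    by apply/measurable_EFinP; exact: (measurableT_comp mI).
  apply: integral0_eq => t _.
  rewrite integral_indic //; last exact: measurable_sin0_set.
  by rewrite setIT; exact: IH.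
- apply: integral0_eq => x _.
  rewrite (_ : (fun t => _) =
    (fun t => (\1_[set t | sin (k ord0 ord0 * t + (rV_dot k' x + b)) = 0] t)%:E)); last first.
    apply/funext => t; congr EFin.
    have e : rV_dot k (rV_cons (x, t)) + b = k ord0 ord0 * t + (rV_dot k' x + b).
      by rewrite rV_dot_cons -/k'; ring.
    by rewrite !indicE; congr (nat_of_bool _)%:R; apply/idP/idP;
      rewrite !inE /sin0_set /= e.
  have c := countable_sin_affine_eq0 (rV_dot k' x + b) k00.
  rewrite integral_indic ?setIT //; first exact: countable_lebesgue_measure0.
  by apply: countable_measurable => // t; exact: measurable_set1.
Qed.


End sin_zeros.

(** * The Riemann-Lebesgue lemma along a ray *)

Definition cos_sum (R : realType) (m : nat) (a : R) : R :=
  \sum_(i < m) cos (i.+1%:R * a).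

(** The terms 2 sin(a/2) cos(j a) = sin(j a + a/2) - sin(j a - a/2), for j from 1 to m,
    telescope. *)
Lemma sin_half_cos_sum (R : realType) (m : nat) (a : R) :
  2 * sin (a / 2) * cos_sum m a = sin (m%:R * a + a / 2) - sin (a / 2).
Proof.
elim: m => [|m IH]; first by rewrite /cos_sum big_ord0 mul0r add0r subrr mulr0.
rewrite /cos_sum big_ord_recr mulrDr -/(cos_sum m a) IH.
have -> : m%:R * a + a / 2 = m.+1%:R * a - a / 2.
  by rewrite -[m.+1%:R]natr1; field.
by rewrite sinB sinD; ring.
Qed.

Lemma cos_sum_le (R : realType) (m : nat) (a : R) : `|cos_sum m a| <= m%:R.
Proof.
rewrite (le_trans (ler_norm_sum _ _ _)) //.
rewrite (@le_trans _ _ (\sum_(i < m) 1)) //.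
  by apply: ler_sum => i _; exact: cos_max.
by rewrite sumr_const card_ord.
Qed.

(** By the telescoped formula the sums stay bounded by 1 / |sin(a/2)|, so their means tend to 0. *)
Lemma cos_sum_mean_cvg0 (R : realType) (a : R) : sin (a / 2) != 0 ->
  m.+1%:R^-1 * cos_sum m.+1 a @[m --> \oo] --> 0.
Proof.
move=> s0.
have s0' : 0 < `|sin (a / 2)| by rewrite normr_gt0.
apply: norm_cvg0.
apply: (@squeeze_cvgr _ _ _ _ (cst 0) (fun m => m.+1%:R^-1 * `|sin (a / 2)|^-1)).
- apply: nearW => m; rewrite normr_ge0 /= normrM ger0_norm ?invr_ge0 //.
  rewrite ler_wpM2l ?invr_ge0 // -[leRHS]mul1r ler_pdivlMr //.
  have := congr1 Num.norm (sin_half_cos_sum m.+1 a).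
  rewrite !normrM (ger0_norm (ler0n _ 2)) => e.
  have : 2 * (`|cos_sum m.+1 a| * `|sin (a / 2)|) <= 2.
    rewrite mulrA [_ * `|cos_sum _ _|]mulrC -mulrA [X in X <= _]mulrC -mulrA.
    rewrite [X in X <= _](_ : _ = 2 * `|sin (a / 2)| * `|cos_sum m.+1 a|); last by ring.
    rewrite e (le_trans (ler_normB _ _)) // -[leRHS]/(1 + 1) lerD //;
    exact: sin_max.
  by rewrite -[leRHS]mulr1 ler_pM2l.
- exact: cvg_cst.
- rewrite -(mul0r `|sin (a / 2)|^-1); apply: cvgMl; exact: cvg_harmonic.
Qed.

Section riemann_lebesgue.
Variables (R : realType) (n : nat).
Local Notation mu := (@lebesgue_rV R n).
Variables (g : 'rV[R]_n -> R) (k : 'rV[R]_n).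
Hypothesis ig : mu.-integrable setT (EFin \o g).

Let mg : measurable_fun setT g.
Proof. by apply/measurable_EFinP; exact: measurable_int ig. Qed.

Let measurable_cos_sum m : measurable_fun setT (fun x => cos_sum m (rV_dot k x)).
Proof.
apply: measurable_sum => i.
by under eq_fun do rewrite -rV_dotZl; exact: measurable_cosdot.
Qed.

Let Rintegral_cos_sum m :
  \int[mu]_x (g x * cos_sum m (rV_dot k x)) = \sum_(i < m) fcos g (i.+1%:R *: k).
Proof.
elim: m => [|m IH].
  rewrite big_ord0; under eq_Rintegral do rewrite /cos_sum big_ord0 mulr0.
  by rewrite Rintegral_cst // mul0r.
rewrite big_ord_recr /= -IH /fcos -RintegralD //.
- by apply: eq_Rintegral => x _; rewrite /cos_sum big_ord_recr mulrDr rV_dotZl.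
- apply: (integrable_mul_bounded (M := m%:R)) => //.
  by move=> x; exact: cos_sum_le.
- exact: integrable_mulcos.
Qed.

(** A weak form of the Riemann-Lebesgue lemma, obtained by averaging. The mean of [fcos g] over k,
    2k, ..., (m+1)k is the integral of [g] against a mean of cosines. That mean tends to 0 off the
    null set sin(k.x / 2) = 0 and is bounded by 1, so by dominated convergence the averages tend to
    0 and cannot all be at least [eps]. *)
Lemma riemann_lebesgue_ray (eps : R) : k != 0 -> 0 < eps ->
  exists m : nat, fcos g (m.+1%:R *: k) < eps.
Proof.
move=> k0 eps0; apply: contrapT => noex.
have ge m : eps <= fcos g (m.+1%:R *: k).
  by rewrite leNgt; apply/negP => lt; apply: noex; exists m.
have cvg0 : \int[mu]_x (g x * (m.+1%:R^-1 * cos_sum m.+1 (rV_dot k x))) @[m --> \oo]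
    --> \int[mu]_x (cst 0 x : R).
  apply: (Rintegral_dominated_cvg (h := fun x => `|g x|)) => //.
  - by move=> m; do 2 apply: measurable_funM => //.
  - have := lebesgue_rV_sin_eq0 0 (k := 2^-1 *: k).
    rewrite scaler_eq0 invr_eq0 pnatr_eq0 /= => /(_ k0) null.
    exists [set x | sin (rV_dot (2^-1 *: k) x + 0) = 0]; split => //.
      rewrite -[X in measurable X]setTI.
      exact: (measurable_sin_dot _ _ measurableT (measurable_set1 0)).
    move=> x /=; apply: contra_notP => s0.
    rewrite -(mulr0 (g x)); apply: cvgMr; apply: cos_sum_mean_cvg0.
    by apply/eqP => sx; apply: s0; rewrite addr0 rV_dotZl mulrC.
  - by have := integrable_norm ig.
  - apply: aeW => x m; rewrite normrM -[leRHS]mulr1 ler_wpM2l //.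
    rewrite normrM ger0_norm ?invr_ge0 // mulrC ler_pdivrMr ?ltr0n // mul1r.
    exact: cos_sum_le.
have : eps <= 0.
  have -> : 0 = \int[mu]_x (cst 0 x : R) :> R by rewrite Rintegral_cst // mul0r.
  apply: (ler_cvg_to (cvg_cst eps) cvg0); apply: nearW => m.
  under eq_Rintegral do rewrite mulrCA.
  rewrite RintegralZl //; last first.
    apply: (integrable_mul_bounded (M := m.+1%:R)) => //.
    by move=> x; exact: cos_sum_le.
  rewrite Rintegral_cos_sum mulrC ler_pdivlMr ?ltr0n //.
  rewrite (_ : eps * _ = \sum_(i < m.+1) eps); first exact: ler_sum.
  by rewrite sumr_const card_ord mulr_natr.
by rewrite leNgt eps0.
Qed.

End riemann_lebesgue.

(** * Approximating half-lines by sines *)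

(** A polynomial with attracting fixed points 0 and 1 and a repelling one at 1/2: on [0, 1] its
    iterates converge to a step at 1/2. Since it is a polynomial, it preserves any algebra of
    functions that contains the constants. *)
Definition smoothstep (R : realType) (t : R) : R := t ^+ 2 * (3 - 2 * t).

Section smoothstep.
Variable R : realType.
Implicit Types t q : R.

Lemma smoothstep_itv t : 0 <= t <= 1 -> 0 <= smoothstep t <= 1.
Proof.
rewrite /smoothstep => /andP[t0 t1]; apply/andP; split.
  by rewrite mulr_ge0 ?sqr_ge0 //; lra.
rewrite -subr_ge0 (_ : _ - _ = (1 - t) ^+ 2 * (1 + 2 * t)); last by ring.
by rewrite mulr_ge0 ?sqr_ge0 //; lra.
Qed.

Lemma iter_smoothstep_itv m t : 0 <= t <= 1 ->
  0 <= iter m (@smoothstep R) t <= 1.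
Proof. by move=> t01; elim: m => //= m; exact: smoothstep_itv. Qed.

Lemma iter_smoothstep_cvg0 t : 0 <= t < 2^-1 ->
  iter m (@smoothstep R) t @[m --> \oo] --> (0 : R).
Proof.
move=> /andP[t0 t12].
(* [r] is the first contraction ratio [smoothstep t / t], and 1 - r = (1 - t)(1 - 2t) > 0. As s(3 -
   2s) is at most [r] for s between 0 and t, all later ratios are bounded by [r] too. *)
pose r := t * (3 - 2 * t).
have r0 : 0 <= r by rewrite /r; nra.
have r1 : r < 1 by rewrite /r; nra.
have ub m : 0 <= iter m (@smoothstep R) t <= t * r ^+ m.
  elim: m => [|m /andP[s0 sr]]; first by rewrite /= expr0 mulr1 t0 lexx.
  rewrite iterS; set s := iter m _ t in s0 sr *.
  have rm : 0 <= r ^+ m <= 1 by rewrite exprn_ge0 //= exprn_ile1 // ltW.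
  have st : s <= t by nra.
  have : 0 <= smoothstep s <= s * r.
    rewrite /smoothstep; apply/andP; split.
      by rewrite mulr_ge0 ?sqr_ge0 //; lra.
    rewrite -subr_ge0 (_ : _ - _ = s * ((t - s) * (3 - 2 * (s + t)))).
      by rewrite !mulr_ge0 //; lra.
    by rewrite /r; ring.
  move=> /andP[-> /= h]; apply: (le_trans h).
  by rewrite exprSr mulrA ler_wpM2r.
apply: (@squeeze_cvgr _ _ _ _ (cst 0) (fun m => t * r ^+ m)).
- exact: nearW.
- exact: cvg_cst.
- rewrite -(mulr0 t); apply: cvgMr; apply: cvg_expr.
  by rewrite ger0_norm.
Qed.

Lemma iter_smoothstepC m t :
  iter m (@smoothstep R) (1 - t) = 1 - iter m (@smoothstep R) t.
Proof. by elim: m => //= m ->; rewrite /smoothstep; ring. Qed.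

Lemma iter_smoothstep_cvg1 t : 2^-1 < t <= 1 ->
  iter m (@smoothstep R) t @[m --> \oo] --> (1 : R).
Proof.
move=> /andP[t12 t1].
have -> : (fun m => iter m (@smoothstep R) t) =
    (fun m => 1 - iter m (@smoothstep R) (1 - t)).
  by apply/funext => m; rewrite iter_smoothstepC opprB addrC subrK.
rewrite -[X in _ --> X]subr0; apply: cvgB; first exact: cvg_cst.
by apply: iter_smoothstep_cvg0; apply/andP; split; lra.
Qed.

Lemma iter_smoothstep_half m : iter m (@smoothstep R) 2^-1 = 2^-1.
Proof. by elim: m => //= m ->; rewrite /smoothstep; field. Qed.

(** The value 1/2 at 0 is forced: it is the fixed point of [smoothstep] at which the iteration
    started from x = 0 stays. *)
Definition half_heaviside (x : R) : R := ((0 < x)%R%:R + (0 <= x)%R%:R) / 2.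

Lemma iter_smoothstep_cvg (x : R) : `|x| <= 1 ->
  iter m (@smoothstep R) (x / 2 + 2^-1) @[m --> \oo] --> half_heaviside x.
Proof.
rewrite ler_norml => /andP[x1 x1'].
rewrite /half_heaviside; case: (ltgtP 0 x) => [x0|x0|<-].
- rewrite (_ : (_ + _) / 2 = 1); last by rewrite -[_ + _]/(2%:R) divff ?pnatr_eq0.
  by apply: iter_smoothstep_cvg1; apply/andP; split; lra.
- rewrite (_ : (_ + _) / 2 = 0); last by rewrite addr0 mul0r.
  by apply: iter_smoothstep_cvg0; apply/andP; split; lra.
- rewrite (_ : (_ + _) / 2 = 2^-1); last by rewrite add0r mul1r.
  rewrite mul0r add0r; apply: cvg_near_cst; apply: nearW => m.
  by rewrite iter_smoothstep_half.
Qed.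

(** Once m is large both scaled arguments lie in [-pi/2, pi/2], where the sine is increasing; the
    sign of the difference is then that of x - c and the sequence is constant. *)
Lemma sin_scale_cvg (x c : R) :
  half_heaviside ((sin (m.+1%:R^-1 * x) - sin (m.+1%:R^-1 * c)) / 2)
    @[m --> \oo] --> half_heaviside (x - c).
Proof.
have small (y : R) : \forall m \near \oo, m.+1%:R^-1 * y \in `[(- (pi/2)), pi/2].
  have : m.+1%:R^-1 * y @[m --> \oo] --> (0 : R).
    by rewrite -(mul0r y); apply: cvgMl; exact: cvg_harmonic.
  move=> /cvgr0Pnorm_le /(_ (pi / 2)); rewrite divr_gt0 ?pi_gt0 // => /(_ isT).
  by apply: filterS => m; rewrite in_itv /= ler_norml.
apply: cvg_near_cst; near=> m.
have xs : m.+1%:R^-1 * x \in `[(- (pi/2)), pi/2] by near: m; exact: small.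
have cs : m.+1%:R^-1 * c \in `[(- (pi/2)), pi/2] by near: m; exact: small.
have m0 : 0 < m.+1%:R^-1 :> R by rewrite invr_gt0.
rewrite /half_heaviside pmulr_lgt0 ?invr_gt0 // pmulr_lge0 ?invr_gt0 //.
rewrite !subr_gt0 !subr_ge0 ltr_sin // ltr_pM2l //.
by rewrite leNgt ltr_sin // ltr_pM2l // -leNgt.
Unshelve. all: by end_near. Qed.

Lemma half_heaviside_le1 x : `|half_heaviside x| <= 1.
Proof.
by rewrite /half_heaviside; case: ltgtP => _ /=; rewrite ger0_norm; lra.
Qed.

End smoothstep.

(** * Uniqueness *)

Section uniqueness.
Variables (R : realType) (n : nat) (h : 'rV[R]_n -> R).
Local Notation mu := (@lebesgue_rV R n).
Hypothesis ih : mu.-integrable setT (EFin \o h).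

Let mh : measurable_fun setT h.
Proof. by apply/measurable_EFinP; exact: measurable_int ih. Qed.

(* The bounded functions p such that all Fourier coefficients of h p vanish. The
   functions preserving this class under multiplication form an algebra that
   contains the sines and is closed under bounded pointwise limits. *)
Definition annihilated (p : 'rV[R]_n -> R) : Prop :=
  [/\ measurable_fun setT p, exists M, forall x, `|p x| <= M &
      forall k a, \int[mu]_x (h x * p x * cos (rV_dot k x + a)) = 0].

Lemma integrable_annihilated p k a : annihilated p ->
  mu.-integrable setT (EFin \o (fun x => h x * p x * cos (rV_dot k x + a))).
Proof.
move=> [mp [M pM] _]; apply: (integrable_mul_bounded (M := 1)).
- exact: (integrable_mul_bounded (M := M)).
- exact: measurable_cos_dot.
- by move=> x; exact: cos_max.
Qed.

Lemma annihilatedD p q : annihilated p -> annihilated q ->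
  annihilated (fun x => p x + q x).
Proof.
move=> ap aq; have [mp [M pM] p0] := ap; have [mq [N qN] q0] := aq; split.
- exact: measurable_funD.
- exists (M + N) => x; exact: le_trans (ler_normD _ _) (lerD (pM x) (qN x)).
- move=> k a.
  under eq_Rintegral do rewrite mulrDr mulrDl.
  rewrite RintegralD //; try exact: integrable_annihilated.
  by rewrite p0 q0 addr0.
Qed.

Lemma annihilatedZ c p : annihilated p -> annihilated (fun x => c * p x).
Proof.
move=> ap; have [mp [M pM] p0] := ap; split.
- exact: measurable_funM.
- by exists (`|c| * M) => x; rewrite normrM ler_wpM2l.
- move=> k a.
  under eq_Rintegral do rewrite mulrCA -mulrA.
  rewrite RintegralZl //; last exact: integrable_annihilated.
  by rewrite p0 mulr0.
Qed.

Lemma annihilated_lim (p_ : nat -> 'rV[R]_n -> R) (p : 'rV[R]_n -> R) M :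
  (forall m, annihilated (p_ m)) -> (forall m x, `|p_ m x| <= M) ->
  (forall x, p_ m x @[m --> \oo] --> p x) -> annihilated p.
Proof.
move=> ap pM p_p.
have mp : measurable_fun setT p.
  by apply: (measurable_fun_cvg (h := p_)) => // m; have [] := ap m.
split => //.
- exists M => x; rewrite ler_norml; apply/andP; split.
    apply: (ler_cvg_to (cvg_cst (- M)) (p_p x)); apply: nearW => m.
    by have := pM m x; rewrite ler_norml => /andP[].
  apply: (ler_cvg_to (p_p x) (cvg_cst M)); apply: nearW => m.
  by have := pM m x; rewrite ler_norml => /andP[].
- move=> k a.
  have c : \int[mu]_x (h x * p_ m x * cos (rV_dot k x + a)) @[m --> \oo] -->
      \int[mu]_x (h x * p x * cos (rV_dot k x + a)).
    apply: (Rintegral_dominated_cvg (h := fun x => `|h x| * M)).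
    + move=> m; apply/measurable_EFinP.
      exact: (measurable_int mu (integrable_annihilated k a (ap m))).
    + apply: measurable_funM; first exact: measurable_funM.
      exact: measurable_cos_dot.
    + apply: aeW => x; apply: cvgMl; exact: cvgMr.
    + have := integrableZr measurableT M (integrable_norm ih).
      by under eq_fun do rewrite /= -EFinM.
    + apply: aeW => x m; rewrite !normrM -[leRHS]mulr1.
      by rewrite ler_pM // ?mulr_ge0 ?ler_wpM2l // cos_max.
  move: c; under eq_fun => m do have [_ _ ->] := ap m.
  by move=> c; apply/esym/(cvg_unique (@norm_hausdorff _ _) (cvg_cst 0) c).
Qed.

Definition multiplier (q : 'rV[R]_n -> R) : Prop :=
  forall p, annihilated p -> annihilated (fun x => p x * q x).

Lemma multiplier_cst c : multiplier (cst c).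
Proof.
by move=> p ap; under eq_fun do rewrite mulrC; exact: annihilatedZ.
Qed.

Lemma multiplierD q r : multiplier q -> multiplier r ->
  multiplier (fun x => q x + r x).
Proof.
move=> mq mr p ap; under eq_fun do rewrite mulrDr.
by apply: annihilatedD; [exact: mq|exact: mr].
Qed.

Lemma multiplierM q r : multiplier q -> multiplier r ->
  multiplier (fun x => q x * r x).
Proof.
by move=> mq mr p ap; under eq_fun do rewrite mulrA; apply: mr; exact: mq.
Qed.

Lemma multiplierZ c q : multiplier q -> multiplier (fun x => c * q x).
Proof. exact: (multiplierM (multiplier_cst c)). Qed.

Lemma multiplierB q r : multiplier q -> multiplier r ->
  multiplier (fun x => q x - r x).
Proof.
move=> mq mr; apply: multiplierD => //.
by under eq_fun do rewrite -mulN1r; exact: multiplierZ.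
Qed.

Lemma multiplier_lim (q_ : nat -> 'rV[R]_n -> R) (q : 'rV[R]_n -> R) :
  (forall m, multiplier (q_ m)) -> (forall m x, `|q_ m x| <= 1) ->
  (forall x, q_ m x @[m --> \oo] --> q x) -> multiplier q.
Proof.
move=> mq q1 q_q p ap; have [_ [M pM] _] := ap.
apply: (@annihilated_lim (fun m x => p x * q_ m x) _ M).
- by move=> m; exact: mq.
- by move=> m x; rewrite normrM -[leRHS]mulr1 ler_pM.
- by move=> x; exact: cvgMr.
Qed.

(** Write the sine as a cosine shifted by pi/2 and turn the product of two cosines into a sum: the
    result involves the frequencies k + l and k - l with new phases. This is why [annihilated]
    quantifies over all phases. *)
Lemma multiplier_sin k b : multiplier (fun x => sin (rV_dot k x + b)).
Proof.
move=> p ap; have [mp [M pM] p0] := ap; split.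
- by apply: measurable_funM => //; exact: measurable_sin_dot.
- by exists M => x; rewrite normrM -[leRHS]mulr1 ler_pM // sin_max.
- move=> l a; pose b' := b - pi / 2.
  transitivity (\int[mu]_x
    (2^-1 * (h x * p x * cos (rV_dot (k + l) x + (b' + a))) +
     2^-1 * (h x * p x * cos (rV_dot (k - l) x + (b' - a))))).
    apply: eq_Rintegral => x _.
    rewrite -cosBpihalf rV_dotDl rV_dotDl rV_dotNl.
    set u := rV_dot k x + b - pi / 2; set v := rV_dot l x + a.
    have -> : rV_dot k x + rV_dot l x + (b' + a) = u + v.
      by rewrite /u /v /b'; ring.
    have -> : rV_dot k x - rV_dot l x + (b' - a) = u - v.
      by rewrite /u /v /b'; ring.
    by rewrite cosD cosB; field.
  rewrite RintegralD //; last 2 first.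
  + exact: (integrableZl measurableT _ (integrable_annihilated _ _ ap)).
  + exact: (integrableZl measurableT _ (integrable_annihilated _ _ ap)).
  rewrite !RintegralZl //; try exact: integrable_annihilated.
  by rewrite !p0 !mulr0 addr0.
Qed.

(** The argument is a multiplier with values in [-1, 1]. Mapped affinely into [0, 1], with 0 going
    to 1/2, it is fed to the iterates of [smoothstep], which are polynomials in it. *)
Lemma multiplier_half_heaviside_sin k b c : `|c| <= 1 ->
  multiplier (fun x => half_heaviside ((sin (rV_dot k x + b) - c) / 2)).
Proof.
move=> c1; pose s x := (sin (rV_dot k x + b) - c) / 2.
have s1 x : `|s x| <= 1.
  rewrite /s normrM [`|2^-1|]ger0_norm ?invr_ge0 // ler_pdivrMr // mul1r.
  by rewrite (le_trans (ler_normB _ _)) // -[leRHS]/(1 + 1) lerD // sin_max.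
have ms : multiplier s.
  rewrite /s; under eq_fun do rewrite mulrC; apply: multiplierZ.
  by apply: multiplierB; [exact: multiplier_sin|exact: multiplier_cst].
have t01 x : 0 <= s x / 2 + 2^-1 <= 1.
  by have := s1 x; rewrite ler_norml => /andP[? ?]; apply/andP; split; lra.
apply: (@multiplier_lim (fun m x => iter m (@smoothstep R) (s x / 2 + 2^-1))).
- elim=> [|m IH].
    under eq_fun do rewrite /= mulrC.
    by apply: multiplierD; [exact: multiplierZ|exact: multiplier_cst].
  rewrite /= /smoothstep; under eq_fun do rewrite expr2.
  apply: multiplierM; first exact: multiplierM.
  apply: multiplierB; first exact: multiplier_cst.
  exact: multiplierZ.
- move=> m x; have /andP[i0 i1] := iter_smoothstep_itv m (t01 x).
  by rewrite ger0_norm.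
- by move=> x; exact: iter_smoothstep_cvg.
Qed.

Lemma multiplier_coord_gt (i : 'I_n) (c : R) :
  multiplier \1_[set x : 'rV[R]_n | c < x ord0 i].
Proof.
have hh : multiplier (fun x => half_heaviside (x ord0 i - c)).
  apply: (@multiplier_lim (fun m x => half_heaviside
    ((sin (m.+1%:R^-1 * x ord0 i) - sin (m.+1%:R^-1 * c)) / 2))).
  - move=> m; have := @multiplier_half_heaviside_sin
      (m.+1%:R^-1 *: delta_mx ord0 i) 0 _ (sin_max (m.+1%:R^-1 * c)).
    by under eq_fun do rewrite addr0 rV_dotZl rV_dot_delta.
  - by move=> m x; exact: half_heaviside_le1.
  - by move=> x; exact: sin_scale_cvg.
(* The polynomial H (2 H - 1) sends the values 0, 1/2, 1 to 0, 0, 1 and so removes the value 1/2 at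
   the endpoint. *)
rewrite (_ : \1__ = fun x : 'rV[R]_n => half_heaviside (x ord0 i - c) *
    (2 * half_heaviside (x ord0 i - c) - 1)); last first.
  apply/funext => x; rewrite indicE /half_heaviside subr_gt0 subr_ge0.
  case: (ltgtP c (x ord0 i)) => cx.
  - by rewrite mem_set //=; field.
  - by rewrite memNset /= ?addr0 ?mul0r //; apply/negP; rewrite -leNgt ltW.
  - rewrite memNset /=; last by rewrite cx ltxx.
    by field.
apply: multiplierM => //; apply: multiplierB; last exact: multiplier_cst.
exact: multiplierZ.
Qed.

(** Complements come from 1 - q. Countable unions are complements of intersections, whose indicator
    is the pointwise limit of finite products of indicators. *)
Lemma sigma_algebra_multiplier :
  sigma_algebra setT [set A : set 'rV[R]_n | multiplier \1_A].
Proof.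
have mC (A : set 'rV[R]_n) : multiplier \1_A -> multiplier \1_(~` A).
  move=> mA; rewrite (_ : \1__ = fun x : 'rV[R]_n => cst 1 x - \1_A x).
    by apply: multiplierB => //; exact: multiplier_cst.
  by apply/funext => x; rewrite !indicE in_setC; case: (_ \in _); rewrite ?subrr ?subr0.
split=> /=.
- by rewrite indic0; exact: (multiplier_cst 0).
- by move=> A; rewrite setTD; exact: mC.
- move=> A mA; rewrite -[\bigcup_k A k]setCK; apply: (mC).
  apply: (@multiplier_lim (fun m x => \prod_(i < m) \1_(~` A i) x)).
  + elim=> [|m IH].
      by under eq_fun do rewrite big_ord0; exact: (multiplier_cst 1).
    under eq_fun do rewrite big_ord_recr /=.
    by apply: multiplierM => //; apply: (mC); exact: mA.
  + move=> m x; elim/big_ind : _ => [|a b a1 b1|i _].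
    * by rewrite normr1.
    * by rewrite normrM -[leRHS]mulr1 ler_pM.
    * by rewrite indicE; case: (_ \in _); rewrite ?normr1 ?normr0.
  + move=> x; rewrite setC_bigcup indicE.
    have [xA|] := boolP (x \in _).
      apply: cvg_near_cst; apply: nearW => m.
      rewrite big1 // => i _; rewrite indicE mem_set //.
      by move: xA; rewrite inE => /(_ i Logic.I).
    rewrite notin_setE => /existsNP[j] /not_implyP[_ xAj].
    apply: cvg_near_cst; exists j.+1 => // m /= jm.
    rewrite (bigD1 (Ordinal jm)) //= indicE memNset // ?mul0r //.
Qed.

(** For each coordinate, the sets of reals whose cylinder has a multiplier as indicator form a
    sigma-algebra; it contains the open upper half-lines, which generate the Borel sets. *)
Lemma multiplier_indic (A : set 'rV[R]_n) : measurable A -> multiplier \1_A.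
Proof.
apply: (smallest_sub sigma_algebra_multiplier).
move=> B; rewrite -bigcup_seq => -[i _ [C mC <-]]; rewrite setTI /=.
have [S0 SC SU] := sigma_algebra_multiplier.
have sC : sigma_algebra setT [set C : set R | multiplier \1_(rV_coord i @^-1` C)].
  split => /=.
  - by rewrite preimage_set0; exact: S0.
  - by move=> D /SC; rewrite setTD preimage_setC setTD.
  - by move=> F /SU; rewrite preimage_bigcup.
move: mC; rewrite [measurable]RGenOInfty.measurableE.
apply: (smallest_sub sC) => _ [c ->].
have e : @rV_coord R n i @^-1` `]c, +oo[ = [set x | c < x ord0 i].
  by apply/seteqP; split => x /=; rewrite in_itv /= andbT.
by change (multiplier \1_(@rV_coord R n i @^-1` `]c, +oo[)); rewrite e;
  exact: multiplier_coord_gt.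
Qed.

(** The hypotheses say that the constant 1 is annihilated, hence so is the indicator of every
    measurable E. Frequency 0 and phase 0 then give a zero integral of [h] over E. *)
Lemma trigonometric_transform_eq0 :
  (forall k, fcos h k = 0) -> (forall k, fsin h k = 0) ->
  {ae mu, forall x, h x = 0}.
Proof.
move=> hc hs.
have a1 : annihilated (cst 1).
  split => //; first by exists 1 => x; rewrite normr1.
  move=> k a; under eq_Rintegral do rewrite mulr1.
  by rewrite Rintegral_mulcosD // hc hs !mulr0 subrr.
have : ae_eq mu setT (EFin \o h) (cst 0%E).
  apply: integral_ae_eq => // E _ mE.
  have [_ _ /(_ 0 0)] := multiplier_indic mE a1.
  under eq_Rintegral do rewrite rV_dot0l addr0 cos0 mulr1 mul1r.
  move=> IE; rewrite integral0 integral_mkcond.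
  have iE : mu.-integrable setT (EFin \o (fun x => h x * \1_E x)).
    apply: (integrable_mul_bounded (M := 1)) => //.
    by move=> x; rewrite indicE; case: (_ \in _); rewrite ?normr1 ?normr0.
  have := fineK (integrable_fin_num measurableT iE).
  rewrite -[fine _]/(\int[mu]_x (h x * \1_E x)) IE => IE0.
  rewrite -[RHS]/(0%:E) IE0; apply: eq_integral => x _; rewrite patchE /= indicE.
  by case: (_ \in _); rewrite ?mulr1 ?mulr0.
by apply: filterS => x /= /(_ Logic.I) [].
Qed.

End uniqueness.

(** * The minimal solution of F = u + F * F *)

(** Finite integrals make both functions finite almost everywhere; the difference of their real
    versions is then non-negative almost everywhere with integral 0. *)
Lemma ge0_le_integral_ae_eq d (T : measurableType d) (R : realType)
    (mu : {measure set T -> \bar R}) (a b : T -> \bar R) :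
  measurable_fun setT a -> measurable_fun setT b ->
  (forall x, 0 <= a x)%E -> (forall x, a x <= b x)%E ->
  (\int[mu]_x b x < +oo)%E -> (\int[mu]_x a x = \int[mu]_x b x)%E ->
  {ae mu, forall x, a x = b x}.
Proof.
move=> ma mb a0 ab boo Iab.
have b0 x : (0 <= b x)%E by exact: le_trans (a0 x) (ab x).
have ib : mu.-integrable setT b.
  apply/integrableP; split => //.
  by under eq_integral do rewrite gee0_abs //.
have ia : mu.-integrable setT a.
  apply/integrableP; split => //.
  by under eq_integral do rewrite gee0_abs //; rewrite Iab.
have fin_ab : {ae mu, forall x, a x \is a fin_num /\ b x \is a fin_num}.
  by apply: filterS2 (integrable_ae measurableT ia) (integrable_ae measurableT ib)
    => x /(_ Logic.I) ? /(_ Logic.I) ?.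
pose c x := fine (b x) - fine (a x).
have ifine (g : T -> \bar R) : mu.-integrable setT g ->
    mu.-integrable setT (EFin \o (fine \o g)) /\
    (\int[mu]_x (fine \o g) x)%R = fine (\int[mu]_x g x)%E.
  move=> ig; have mg := measurable_int mu ig.
  have mfg : measurable_fun setT (EFin \o (fine \o g)).
    by apply/measurable_EFinP; exact: measurableT_comp.
  have gg : {ae mu, forall x, setT x -> (EFin \o (fine \o g)) x = g x}.
    by apply: filterS (integrable_ae measurableT ig) => x gx _ /=; rewrite fineK // gx.
  split; last by congr fine; exact: ae_eq_integral.
  have /integrableP[_ goo] := ig.
  apply/integrableP; split => //; apply: le_lt_trans goo.
  rewrite le_eqVlt; apply/orP; left; apply/eqP; apply: ae_eq_integral => //.
  - exact: measurableT_comp.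
  - exact: measurableT_comp.
  - by apply: filterS gg => x gx _; rewrite gx.
have [ifa Ifa] := ifine _ ia; have [ifb Ifb] := ifine _ ib.
have : {ae mu, forall x, c x = 0}.
  apply: ge0_Rintegral_eq0.
  - exact: (integrableB measurableT ifb ifa).
  - by apply: filterS fin_ab => x [? ?]; rewrite /c subr_ge0 fine_le.
  - by rewrite /c RintegralB // Ifa Ifb Iab subrr.
move=> c0; apply: filterS2 fin_ab c0 => x [afin bfin] /eqP.
by rewrite /c subr_eq0 => /eqP cx; rewrite -(fineK afin) -cx fineK.
Qed.

Lemma measurable_conv_kernelr (R : realType) (n : nat)
    (G : 'rV[R]_n -> \bar R) (x : 'rV[R]_n) :
  measurable_fun setT G ->
  measurable_fun setT (fun y : 'rV[R]_n => G (x - y)%R * G y)%E.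
Proof.
by move=> mG; exact: (measurableT_comp (measurable_conv_kernel mG)
  (measurable_pair1 x)).
Qed.

Section convolution_equation.
Variables (R : realType) (n : nat) (u : 'rV[R]_n -> R).
Local Notation mu := (@lebesgue_rV R n).
Hypothesis umeas : measurable_fun setT u.
Hypothesis u0 : forall x, 0 <= u x.
Hypothesis u4 : (\int[mu]_x (u x)%:E <= (4^-1)%:E)%E.

Fixpoint conv_iter (m : nat) (x : 'rV[R]_n) : \bar R :=
  match m with
  | 0%N => 0%E
  | m'.+1 => ((u x)%:E + econv (conv_iter m') x)%E
  end.

Lemma conv_iter_ge0 m x : (0 <= conv_iter m x)%E.
Proof.
by elim: m x => //= m IH x; rewrite adde_ge0 ?lee_fin //; exact: econv_ge0.
Qed.

Lemma measurable_conv_iter m : measurable_fun setT (conv_iter m).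
Proof.
elim: m => [|m IH] /=; first exact: measurable_cst.
apply: emeasurable_funD; first exact/measurable_EFinP.
by apply: measurable_econv => // x; exact: conv_iter_ge0.
Qed.

Lemma conv_iterS_le m x : (conv_iter m x <= conv_iter m.+1 x)%E.
Proof.
elim: m x => [|m IH] x; first exact: conv_iter_ge0.
rewrite [conv_iter m.+1]/= [conv_iter m.+2]/= leeD2l //.
apply: ge0_le_integral => //.
- by move=> y _; rewrite mule_ge0 ?conv_iter_ge0.
- exact: (measurable_conv_kernelr x (measurable_conv_iter m)).
- exact: (measurable_conv_kernelr x (measurable_conv_iter m.+1)).
- by move=> y _; apply: lee_pmul => //; rewrite conv_iter_ge0.
Qed.

Lemma nondecreasing_conv_iter x : nondecreasing_seq (conv_iter ^~ x).
Proof. by apply/nondecreasing_seqP => m; exact: conv_iterS_le. Qed.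

(** The bound 1/2 propagates because it solves I = 1/4 + I^2. *)
Lemma integral_conv_iter_le m : (\int[mu]_x conv_iter m x <= (2^-1)%:E)%E.
Proof.
elim: m => [|m IH]; first by rewrite integral0 lee_fin.
have I0 : (0 <= \int[mu]_x conv_iter m x)%E.
  by apply: integral_ge0 => x _; exact: conv_iter_ge0.
have e0 x : (0 <= econv (conv_iter m) x)%E.
  by apply: econv_ge0; exact: conv_iter_ge0.
rewrite ge0_integralD //; last 3 first.
- by move=> x _; rewrite lee_fin.
- exact/measurable_EFinP.
- by apply: measurable_econv; [exact: measurable_conv_iter|exact: conv_iter_ge0].
rewrite integral_econv; [|exact: measurable_conv_iter|exact: conv_iter_ge0].
have -> : (2^-1)%:E = ((4^-1)%:E + (2^-1)%:E * (2^-1)%:E)%E :> \bar R.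
  by rewrite -EFinM -EFinD; congr EFin; field.
by apply: leeD => //; apply: lee_pmul.
Qed.

Definition conv_lim (x : 'rV[R]_n) : \bar R := limn (conv_iter ^~ x).

Lemma conv_iter_cvg x : conv_iter m x @[m --> \oo] --> conv_lim x.
Proof. exact: ereal_nondecreasing_is_cvgn (nondecreasing_conv_iter x). Qed.

Lemma conv_iter_le_lim m x : (conv_iter m x <= conv_lim x)%E.
Proof.
apply: lime_ge; first exact: conv_iter_cvg.
by exists m => // p /= mp; exact: nondecreasing_conv_iter.
Qed.

Lemma conv_lim_ge0 x : (0 <= conv_lim x)%E.
Proof. exact: conv_iter_le_lim 0%N x. Qed.

Lemma measurable_conv_lim : measurable_fun setT conv_lim.
Proof.
apply: (emeasurable_fun_cvg conv_iter); first exact: measurable_conv_iter.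
by move=> x _; exact: conv_iter_cvg.
Qed.

(** Multiplication on [0, +oo] is discontinuous at 0 * oo. This does no harm here: if one limit is
    0, then by monotonicity all its iterates are 0 and so are the products. *)
Lemma conv_iterM_cvg x y :
  (conv_iter m x * conv_iter m y)%E @[m --> \oo] --> (conv_lim x * conv_lim y)%E.
Proof.
have z w : conv_lim w = 0%E -> forall m, conv_iter m w = 0%E.
  move=> w0 m; apply/eqP; rewrite eq_le conv_iter_ge0 andbT -w0.
  exact: conv_iter_le_lim.
have [x0|x0] := eqVneq (conv_lim x) 0%E.
  rewrite x0 mul0e; under eq_fun do rewrite z // mul0e; exact: cvg_cst.
have [y0|y0] := eqVneq (conv_lim y) 0%E.
  rewrite y0 mule0; under eq_fun do rewrite [conv_iter _ y]z // mule0.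
  exact: cvg_cst.
apply: cvgeM; [|exact: conv_iter_cvg|exact: conv_iter_cvg].
by apply: neq0_mule_def; rewrite mule_neq0.
Qed.

(** Monotone convergence inside the convolution lets m tend to infinity in the recursion for
    [conv_iter]. *)
Lemma conv_lim_fixpoint x : conv_lim x = ((u x)%:E + econv conv_lim x)%E.
Proof.
have c1 : conv_iter m.+1 x @[m --> \oo] --> conv_lim x.
  by rewrite (cvg_shiftS (conv_iter ^~ x)); exact: conv_iter_cvg.
have c2 : conv_iter m.+1 x @[m --> \oo] --> ((u x)%:E + econv conv_lim x)%E.
  apply: cvgeD; [exact: fin_num_adde_defr|exact: cvg_cst|].
  have -> : econv conv_lim x = (\int[mu]_y
      limn (fun m => conv_iter m (x - y)%R * conv_iter m y))%E.
    by apply: eq_integral => y _; apply/esym/cvg_lim => //; exact: conv_iterM_cvg.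
  apply: (cvg_monotone_convergence measurableT).
  - by move=> m; apply: measurable_conv_kernelr; exact: measurable_conv_iter.
  - by move=> m y _; rewrite mule_ge0 ?conv_iter_ge0.
  - by move=> y _ m p mp; apply: lee_pmul; rewrite ?conv_iter_ge0 //;
      exact: nondecreasing_conv_iter.
exact: (cvg_unique (@ereal_hausdorff R) c1 c2).
Qed.

Lemma integral_conv_lim_le : (\int[mu]_x conv_lim x <= (2^-1)%:E)%E.
Proof.
rewrite monotone_convergence //.
- apply: lime_le; last by apply: nearW => m; exact: integral_conv_iter_le.
  apply: ereal_nondecreasing_is_cvgn => m p mp; apply: ge0_le_integral => //.
  + by move=> x _; exact: conv_iter_ge0.
  + exact: measurable_conv_iter.
  + exact: measurable_conv_iter.
  + by move=> x _; exact: nondecreasing_conv_iter.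
- exact: measurable_conv_iter.
- by move=> m x _; exact: conv_iter_ge0.
- by move=> x _; exact: nondecreasing_conv_iter.
Qed.

Lemma convolution_equation_solution : exists F : 'rV[R]_n -> R,
  [/\ mu.-integrable setT (EFin \o F), forall x, 0 <= F x &
      {ae mu, forall x, F x = u x + convolution F F x}].
Proof.
pose F := fine \o conv_lim.
have mG := measurable_conv_lim; have G0 := conv_lim_ge0.
have F0 x : 0 <= F x by exact: fine_ge0.
have FG x : ((F x)%:E <= conv_lim x)%E.
  by rewrite /F /=; case: (conv_lim x) (G0 x) => //= _; rewrite leey.
have Goo : (\int[mu]_x conv_lim x < +oo)%E.
  exact: le_lt_trans integral_conv_lim_le (ltry _).
have iG : mu.-integrable setT conv_lim.
  apply/integrableP; split => //.
  by under eq_integral do rewrite gee0_abs //.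
have mF : measurable_fun setT (EFin \o F).
  by apply/measurable_EFinP; exact: measurableT_comp.
have Gfin := integrable_ae measurableT iG.
have FGae : {ae mu, forall x, setT x -> (EFin \o F) x = conv_lim x}.
  by apply: filterS Gfin => x gx _ /=; rewrite fineK // gx.
have IFG : (\int[mu]_x (F x)%:E = \int[mu]_x conv_lim x)%E.
  exact: ae_eq_integral.
have iF : mu.-integrable setT (EFin \o F).
  apply/integrableP; split => //.
  by under eq_integral do rewrite gee0_abs ?lee_fin //; rewrite IFG.
exists F; split => //.
have eF0 x : (0 <= (EFin \o F) x)%E by rewrite lee_fin.
(* [F] is pointwise below [conv_lim], so the two convolutions are ordered; their integrals are
   squares of equal finite masses, so they coincide almost everywhere. *)
have : {ae mu, forall x, econv (EFin \o F) x = econv conv_lim x}.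
  apply: ge0_le_integral_ae_eq.
  - exact: measurable_econv.
  - exact: measurable_econv.
  - by move=> x; exact: econv_ge0.
  - move=> x; apply: ge0_le_integral => //.
    + by move=> y _; apply: mule_ge0; exact: eF0.
    + exact: measurable_conv_kernelr.
    + exact: measurable_conv_kernelr.
    + by move=> y _; apply: lee_pmul; [exact: eF0|exact: eF0|exact: FG|exact: FG].
  - rewrite integral_econv // -(@fineK _ (\int[mu]_x conv_lim x)%E).
      by rewrite -EFinM ltry.
    exact: integrable_fin_num.
  - by rewrite !integral_econv // IFG.
move=> cFG; apply: filterS2 cFG Gfin => x cx /(_ Logic.I) Gx.
rewrite /F /= conv_lim_fixpoint -cx fineD //.
by move: Gx; rewrite conv_lim_fixpoint fin_numD -cx => /andP[].
Qed.

End convolution_equation.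

(** * Positivity *)

(** Equality would give the non-negative function F (1 - cos(k.x)) integral 0. As 1 - cos(k.x) = 2
    sin(k.x / 2)^2 is non-zero off a null set, [F] would vanish almost everywhere, against its
    positive mass. *)
Lemma fcos_lt_integral (R : realType) (n : nat) (F : 'rV[R]_n -> R)
    (k : 'rV[R]_n) :
  (@lebesgue_rV R n).-integrable setT (EFin \o F) -> (forall x, 0 <= F x) ->
  0 < \int[@lebesgue_rV R n]_x F x -> k != 0 ->
  fcos F k < \int[@lebesgue_rV R n]_x F x.
Proof.
move=> iF F0 IF k0; rewrite ltNge; apply/negP => le.
have ic := integrable_mulcos k iF.
have id : (@lebesgue_rV R n).-integrable setT
    (EFin \o (fun x => F x - F x * cos (rV_dot k x))).
  exact: (integrableB measurableT iF ic).
have d0 x : 0 <= F x - F x * cos (rV_dot k x).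
  by rewrite subr_ge0 -[leRHS]mulr1 ler_wpM2l // cos_le1.
have Id : \int[@lebesgue_rV R n]_x (F x - F x * cos (rV_dot k x)) = 0.
  apply/eqP; rewrite eq_le; apply/andP; split; last exact: Rintegral_ge0.
  by rewrite RintegralB // subr_le0.
have dae := ge0_Rintegral_eq0 id (aeW _ d0) Id.
have null := lebesgue_rV_sin_eq0 0 (k := 2^-1 *: k).
rewrite scaler_eq0 invr_eq0 pnatr_eq0 /= in null.
have sae : {ae @lebesgue_rV R n, forall x, sin (rV_dot (2^-1 *: k) x + 0) <> 0}.
  exists [set x | sin (rV_dot (2^-1 *: k) x + 0) = 0]; split => //.
  - rewrite -[X in measurable X]setTI.
    exact: (measurable_sin_dot _ _ measurableT (measurable_set1 0)).
  - exact: null.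
  - by move=> x /= /contrapT.
have Fae : {ae @lebesgue_rV R n, forall x, F x = 0}.
  apply: filterS2 dae sae => x dx sx.
  have cE : cos (rV_dot k x) = 1 - 2 * sin (rV_dot (2^-1 *: k) x + 0) ^+ 2.
    rewrite addr0 -[k in LHS](scale1r k) -[1 in LHS](divff (_ : 2 != 0 :> R)) //.
    rewrite -scalerA rV_dotZl mulr_natl cos_mulr2n cos2sin2; ring.
  move: dx; rewrite cE => /eqP.
  rewrite (_ : _ - _ = F x * (2 * sin (rV_dot (2^-1 *: k) x + 0) ^+ 2)); last by ring.
  rewrite mulf_eq0 [_ * (_ ^+ 2) == 0]mulf_eq0 pnatr_eq0 /= sqrf_eq0 => /orP[/eqP//|/eqP]; exact.
have mF : measurable_fun setT F by apply/measurable_EFinP; exact: measurable_int iF.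
have : \int[@lebesgue_rV R n]_x F x = \int[@lebesgue_rV R n]_x (cst 0 x : R).
  exact: ae_eq_Rintegral.
by rewrite Rintegral_cst // mul0r => IF0; move: IF; rewrite IF0 ltxx.
Qed.

Lemma continuous_fcos_ray (R : realType) (n : nat) (g : 'rV[R]_n -> R)
    (k : 'rV[R]_n) :
  (@lebesgue_rV R n).-integrable setT (EFin \o g) ->
  continuous (fun t : R => fcos g (t *: k)).
Proof.
move=> ig t.
apply: (@continuity_under_integral R _ _ (@lebesgue_rV R n)
  (fun t x => g x * cos (rV_dot (t *: k) x)) setT measurableT (t - 1) (t + 1) _ _
  (fun x => `|g x|)).
- by move=> s _; exact: integrable_mulcos.
- apply: aeW => x _ s _.
  under eq_fun do rewrite rV_dotZl.
  apply: cvgMr; apply: continuous_comp; last exact: continuous_cos.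
  by apply: cvgMl; exact: cvg_id.
- by have := integrable_norm ig.
- move=> s _; apply: aeW => x _.
  by rewrite normrM -[leRHS]mulr1 ler_wpM2l // cos_max.
- by rewrite inE /= in_itv /=; apply/andP; split; lra.
Qed.

(* In complex form, z - z^2 = w - w^2 with z = a + ib and w = c + id gives
   (z - w)(1 - z - w) = 0. *)
Lemma quadratic_roots (R : realFieldType) (a b c d : R) :
  a - (a ^+ 2 - b ^+ 2) = c - (c ^+ 2 - d ^+ 2) ->
  b - 2 * (a * b) = d - 2 * (c * d) ->
  (a = c /\ b = d) \/ a = 1 - c.
Proof.
move=> e1 e2.
(* Here p + iq = z - w and r + is = 1 - z - w. [h1] and [h2] are the real and imaginary parts of
   their product; multiplicativity of the squared modulus then makes one factor vanish. *)
pose p := a - c; pose q := b - d; pose r := 1 - a - c; pose s := - (b + d).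
have h1 : p * r - q * s = 0.
  rewrite (_ : _ - _ = (a - (a ^+ 2 - b ^+ 2)) - (c - (c ^+ 2 - d ^+ 2))).
    by rewrite e1 subrr.
  by rewrite /p /q /r /s; ring.
have h2 : p * s + q * r = 0.
  rewrite (_ : _ + _ = (b - 2 * (a * b)) - (d - 2 * (c * d))).
    by rewrite e2 subrr.
  by rewrite /p /q /r /s; ring.
have /eqP : (p ^+ 2 + q ^+ 2) * (r ^+ 2 + s ^+ 2) = 0.
  rewrite (_ : _ * _ = (p * r - q * s) ^+ 2 + (p * s + q * r) ^+ 2); last by ring.
  by rewrite h1 h2 expr0n /= addr0.
rewrite mulf_eq0 !paddr_eq0 ?sqr_ge0 // !sqrf_eq0 => /orP[/andP[]|/andP[]].
  by rewrite !subr_eq0 => /eqP-> /eqP->; left.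
by rewrite /r subr_eq0 => /eqP <- _; right; ring.
Qed.

Section positivity.
Variables (R : realType) (n : nat) (f : 'rV[R]_n -> R).
Local Notation mu := (@lebesgue_rV R n).
Hypothesis hf : mu.-integrable setT (EFin \o f).
Hypothesis hconv : {ae mu, forall x, convolution f f x <= f x}.
Hypothesis hint : \int[mu]_x f x = 2^-1.

Let defect (x : 'rV[R]_n) : R := f x - convolution f f x.

Lemma integrable_defect : mu.-integrable setT (EFin \o defect).
Proof. exact: (integrableB measurableT hf (integrable_convolution hf)). Qed.

Lemma fcos_defect k :
  fcos defect k = fcos f k - (fcos f k ^+ 2 - fsin f k ^+ 2).
Proof.
by rewrite fcosB ?fcos_convolution //; exact: integrable_convolution.
Qed.

Lemma fsin_defect k :
  fsin defect k = fsin f k - 2 * (fcos f k * fsin f k).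
Proof.
by rewrite fsinB ?fsin_convolution //; exact: integrable_convolution.
Qed.

Lemma integral_defect : \int[mu]_x defect x = 4^-1.
Proof. by rewrite -fcos0 fcos_defect fcos0 fsin0 hint; field. Qed.

Lemma convolution_le_ge0 : {ae mu, forall x, 0 <= f x}.
Proof.
(* The positive part agrees with [defect] almost everywhere and is non-negative at every point, as
   the fixed-point construction requires. *)
pose u x := Num.max 0 (defect x).
have md : measurable_fun setT defect.
  by apply/measurable_EFinP; exact: measurable_int integrable_defect.
have mu' : measurable_fun setT u by exact: measurable_maxr.
have u0 x : 0 <= u x by rewrite le_max lexx.
have ud : {ae mu, forall x, u x = defect x}.
  by apply: filterS hconv => x fx; rewrite /u max_r // subr_ge0.
have Iu : (\int[mu]_x (u x)%:E = (4^-1)%:E)%E.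
  rewrite -integral_defect /Rintegral fineK.
    apply: ae_eq_integral => //; try exact/measurable_EFinP.
    by apply: filterS ud => x -> _.
  exact: (integrable_fin_num measurableT integrable_defect).
have [F [iF F0 FE]] := @convolution_equation_solution R n u mu' u0
  (eq_ind _ (fun z => z <= _)%E (lexx _) _ (esym Iu)).
have mF : measurable_fun setT F by apply/measurable_EFinP; exact: measurable_int iF.
have mcF := measurable_convolution iF.
have FD : {ae mu, forall x, defect x = F x - convolution F F x}.
  by apply: filterS2 ud FE => x <- ->; rewrite addrK.
have transE (p : 'rV[R]_n -> R) : measurable_fun setT p ->
    \int[mu]_x (defect x * p x) = \int[mu]_x ((F x - convolution F F x) * p x).
  move=> mp; apply: ae_eq_Rintegral.
  - exact: measurable_funM.
  - by apply: measurable_funM => //; exact: measurable_funB.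
  - by apply: filterS FD => x ->.
have fcE k : fcos f k - (fcos f k ^+ 2 - fsin f k ^+ 2) =
    fcos F k - (fcos F k ^+ 2 - fsin F k ^+ 2).
  rewrite -fcos_defect -fcos_convolution // -fcosB //; last exact: integrable_convolution.
  by apply: transE; exact: measurable_cosdot.
have fsE k : fsin f k - 2 * (fcos f k * fsin f k) =
    fsin F k - 2 * (fcos F k * fsin F k).
  rewrite -fsin_defect -fsin_convolution // -fsinB //; last exact: integrable_convolution.
  by apply: transE; exact: measurable_sindot.
have IF : \int[mu]_x F x = 2^-1.
  have := fcE 0; rewrite !fcos0 !fsin0 hint => e.
  (* At frequency 0 the mass I of [F] satisfies I - I^2 = 1/4, whose only root is the double root
     1/2. *)
  have /eqP : (\int[mu]_x F x - 2^-1) ^+ 2 = 0.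
    set I := \int[mu]_x F x in e *.
    rewrite (_ : _ ^+ 2 = 4^-1 - (I - (I ^+ 2 - 0 ^+ 2))); last by field.
    by rewrite -e; field.
  by rewrite sqrf_eq0 subr_eq0 => /eqP.
have Flt k : k != 0 -> fcos F k < 2^-1.
  by move=> k0; rewrite -IF; apply: fcos_lt_integral; rewrite ?IF ?invr_gt0.
have same k : fcos f k = fcos F k /\ fsin f k = fsin F k.
  have [->|k0] := eqVneq k 0; first by rewrite !fcos0 !fsin0 hint IF.
  have [//|fk] := quadratic_roots (fcE k) (fsE k).
  exfalso.
  have half0 : 0 < 2^-1 :> R by rewrite invr_gt0.
  have [m fm] := riemann_lebesgue_ray hf k0 half0.
  pose G (t : R) := fcos f (t *: k).
  (* On the second root [fcos f k] = 1 - [fcos F k] exceeds 1/2, while at (m+1)k the value is below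
     1/2. At the intermediate point with value 1/2 both roots give [fcos F (t *: k)] = 1/2, which
     [Flt] forbids, since t >= 1 keeps the frequency non-zero. *)
  have [t + Gt] : exists2 t, t \in `[1, m.+1%:R] & G t = 2^-1.
    apply: IVT.
    - by rewrite ler1n.
    - by apply: continuous_subspaceT; exact: continuous_fcos_ray.
    - rewrite /G scale1r ge_min le_max (ltW fm) orbT /= fk.
      by have := Flt k k0; move=> ?; apply/orP; left; lra.
  rewrite in_itv /= => /andP[t1 _].
  have tk0 : t *: k != 0.
    by rewrite scaler_eq0 negb_or k0 andbT gt_eqF // (lt_le_trans ltr01 t1).
  have := Flt _ tk0.
  have [[e _]|e] := quadratic_roots (fcE (t *: k)) (fsE (t *: k));
    move: Gt; rewrite /G e; lra.
have iD : mu.-integrable setT (EFin \o (fun x => f x - F x)).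
  exact: (integrableB measurableT hf iF).
have : {ae mu, forall x, f x - F x = 0}.
  apply: trigonometric_transform_eq0 => // k.
  - by rewrite fcosB // (same k).1 subrr.
  - by rewrite fsinB // (same k).2 subrr.
by apply: filterS => x /eqP; rewrite subr_eq0 => /eqP ->.
Qed.

End positivity.

(** * The first moment *)

Lemma norm_sin_le (R : realType) (x : R) : `|sin x| <= `|x|.
Proof.
wlog x0 : x / 0 <= x.
  move=> H; have [x0|x0] := leP 0 x; first exact: H.
  by have := H (- x); rewrite sinN !normrN oppr_ge0 => ->; rewrite ?ltW.
have [c _] := @MVT_segment R sin cos 0 x x0 (fun y _ => is_derive_sin y)
  (continuous_subspaceT (@continuous_sin R)).
rewrite sin0 !subr0 => ->.
by rewrite normrM -[leRHS]mul1r ler_wpM2r // cos_max.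
Qed.

Lemma one_sub_cos (R : realType) (x : R) : 1 - cos x = 2 * sin (x / 2) ^+ 2.
Proof.
have {1}-> : x = (x / 2) *+ 2 by rewrite -mulr_natr; field.
by rewrite cos_mulr2n cos2sin2; ring.
Qed.

(** The difference of the two sides is 2 (1 - cos x)^2. *)
Lemma one_sub_cos_double (R : realType) (x : R) :
  1 - cos (2 * x) <= 4 * (1 - cos x).
Proof.
rewrite mulr_natl cos_mulr2n.
have := cos_le1 x; have := cos_geN1 x.
rewrite -subr_ge0 => ? ?; rewrite -subr_ge0.
rewrite (_ : _ - _ = 2 * (1 - cos x) ^+ 2); last by ring.
by rewrite mulr_ge0 ?sqr_ge0.
Qed.

Lemma one_sub_cos_dyadic (R : realType) (m : nat) (x : R) :
  1 - cos x <= 4 ^+ m * (1 - cos (2^-1 ^+ m * x)).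
Proof.
elim: m => [|m IH]; first by rewrite !expr0 !mul1r.
apply: (le_trans IH); rewrite exprSr -mulrA ler_wpM2l ?exprn_ge0 //.
have {1}-> : 2^-1 ^+ m * x = 2 * (2^-1 ^+ m.+1 * x) by rewrite exprS; field.
exact: one_sub_cos_double.
Qed.

(** With y = x / 2^(m+1) the middle term is 2^(m+1) sin(y)^2, and sin(y)^2 <= |y|. This gives a
    dominating function uniform in m. *)
Lemma dyadic_one_sub_cos_le (R : realType) (m : nat) (x : R) :
  0 <= 2 ^+ m * (1 - cos (2^-1 ^+ m * x)) <= `|x|.
Proof.
have p2 : 0 < 2 ^+ m :> R by rewrite exprn_gt0.
rewrite one_sub_cos; set y := 2^-1 ^+ m * x / 2.
apply/andP; split.
  by apply: mulr_ge0; [exact: ltW|rewrite mulr_ge0 ?sqr_ge0].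
have -> : `|x| = 2 ^+ m * (2 * `|y|).
  have {1}-> : x = 2 ^+ m * (2 * y).
    by rewrite /y exprVn; field; rewrite gt_eqF.
  by rewrite 2!normrM (gtr0_norm p2) (ger0_norm (ler0n _ 2)).
rewrite !ler_wpM2l // ?(ltW p2) // -real_normK ?num_real // expr2.
rewrite -[leRHS]mul1r ler_pM // ?sin_max //; exact: norm_sin_le.
Qed.

(** Bounding both sine factors by |y| instead gives decay of order 2^-m for fixed x. *)
Lemma dyadic_one_sub_cos_cvg0 (R : realType) (x : R) :
  2 ^+ m * (1 - cos (2^-1 ^+ m * x)) @[m --> \oo] --> (0 : R).
Proof.
apply: (@squeeze_cvgr _ _ _ _ (cst 0) (fun m => x ^+ 2 * 2^-1 ^+ m)).
- apply: nearW => m; have /andP[-> _] /= := dyadic_one_sub_cos_le m x.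
  have p2 : 0 < 2 ^+ m :> R by rewrite exprn_gt0.
  rewrite one_sub_cos; set y := 2^-1 ^+ m * x / 2.
  apply: (@le_trans _ _ (2 ^+ m * (2 * y ^+ 2))).
    rewrite !ler_wpM2l // ?(ltW p2) //.
    rewrite -[leLHS]real_normK ?num_real // -[leRHS]real_normK ?num_real //.
    by rewrite lerXn2r ?nnegrE // norm_sin_le.
  rewrite (_ : 2 ^+ m * _ = 2^-1 * (x ^+ 2 * 2^-1 ^+ m)); last first.
    by rewrite /y exprVn; field; rewrite gt_eqF.
  apply: ler_piMl; last by lra.
  by rewrite mulr_ge0 ?sqr_ge0 ?exprn_ge0 ?invr_ge0.
- exact: cvg_cst.
- rewrite -(mulr0 (x ^+ 2)); apply: cvgMr; apply: cvg_expr.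
  by rewrite ger0_norm ?invr_ge0 // invf_lt1 // ltr1n.
Qed.

Lemma coord_le_eucl_norm (R : realType) (n : nat) (i : 'I_n) (x : 'rV[R]_n) :
  `|x ord0 i| <= eucl_norm x.
Proof.
rewrite /eucl_norm -sqrtr_sqr ler_wsqrtr // (bigD1 i) //= lerDl.
by apply: sumr_ge0 => j _; exact: sqr_ge0.
Qed.

Lemma measurable_eucl_norm (R : realType) (n : nat) :
  measurable_fun setT (@eucl_norm R n).
Proof.
apply: (@measurableT_comp _ _ _ _ _ _ (@Num.sqrt R)).
  by apply: continuous_measurable_fun; exact: sqrt_continuous.
apply: measurable_sum => i; apply: measurable_funX; exact: measurable_rV_coord.
Qed.

Lemma coord_first_moment_infinite (R : realType) (n : nat) (i : 'I_n)
    (f : 'rV[R]_n -> R) :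
  (@lebesgue_rV R n).-integrable setT (EFin \o f) ->
  {ae @lebesgue_rV R n, forall x, convolution f f x <= f x} ->
  \int[@lebesgue_rV R n]_x f x = 2^-1 ->
  ~ (@lebesgue_rV R n).-integrable setT 
    (EFin \o (fun x : 'rV[R]_n => x ord0 i * f x)).
Proof.
move=> hf hconv hint hx.
pose mu := @lebesgue_rV R n.
pose e : 'rV[R]_n := delta_mx ord0 i.
have e0 : e != 0.
  apply/eqP => /matrixP/(_ ord0 i); rewrite !mxE !eqxx /= => /eqP.
  by rewrite oner_eq0.
pose w x := f x - convolution f f x.
have iw : mu.-integrable setT (EFin \o w) := integrable_defect hf.
have Iw : \int[mu]_x w x = 4^-1 := integral_defect hf hint.
pose u x := Num.max 0 (w x).
have mw : measurable_fun setT w by apply/measurable_EFinP; exact: measurable_int iw.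
have mf : measurable_fun setT f by apply/measurable_EFinP; exact: measurable_int hf.
have mu0 : measurable_fun setT u by exact: measurable_maxr.
have u0 x : 0 <= u x by rewrite le_max lexx.
have uw : {ae mu, forall x, u x = w x}.
  by apply: filterS hconv => x fx; rewrite /u max_r // subr_ge0.
have iu : mu.-integrable setT (EFin \o u).
  apply: le_integrable (iw) => //; first exact/measurable_EFinP.
  move=> x _; rewrite lee_fin ger0_norm //.
  by rewrite /u ge_max normr_ge0 ler_norm.
have Iu : \int[mu]_x u x = 4^-1 by rewrite -Iw; exact: ae_eq_Rintegral.
have fu k : fcos u k = fcos w k.
  apply: ae_eq_Rintegral.
  - by apply: measurable_funM => //; exact: measurable_cosdot.
  - by apply: measurable_funM => //; exact: measurable_cosdot.
  - by apply: filterS uw => x ->.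
have lt : fcos u e < 4^-1.
  by rewrite -Iu; apply: fcos_lt_integral => //; rewrite Iu invr_gt0.
(* [C m] is a difference quotient of [fcos f] at 0 along the i-th axis; dominated convergence with
   bound |x_i f(x)| sends it to 0. *)
pose C m := 2 ^+ m * (2^-1 - fcos f (2^-1 ^+ m *: e)).
have CE m : C m = \int[mu]_x (f x * (2 ^+ m * (1 - cos (2^-1 ^+ m * x ord0 i)))).
  rewrite /C -hint -RintegralB //; last exact: integrable_mulcos.
  rewrite -RintegralZl //; last first.
    exact: (integrableB measurableT hf (integrable_mulcos _ hf)).
  by apply: eq_Rintegral => x _; rewrite rV_dotZl rV_dot_delta; ring.
have C0 : C m @[m --> \oo] --> \int[mu]_x (cst 0 x : R).
  rewrite (funext CE : C = _).
  apply: (@Rintegral_dominated_cvg _ _ _ mu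
    (fun m x => f x * (2 ^+ m * (1 - cos (2^-1 ^+ m * x ord0 i)))) (cst 0)
    (fun x => `|x ord0 i * f x|)) => //.
  - move=> m; apply: measurable_funM => //; apply: measurable_funM => //.
    apply: measurable_funB => //.
    rewrite (_ : (fun x => _) = fun x => cos (rV_dot (2^-1 ^+ m *: e) x)).
      exact: measurable_cosdot.
    by apply/funext => x; rewrite rV_dotZl rV_dot_delta.
  - apply: aeW => x; rewrite -(mulr0 (f x)); apply: cvgMr.
    exact: dyadic_one_sub_cos_cvg0.
  - by have := integrable_norm hx.
  - apply: aeW => x m; rewrite !normrM mulrC ler_wpM2r //.
    have /andP[? ?] := dyadic_one_sub_cos_le m (x ord0 i).
    by rewrite -normrM ger0_norm.
rewrite Rintegral_cst // mul0r in C0.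
(* The left side is the integral of u (1 - cos x_i), positive by [lt] and independent of m. The
   dyadic inequality bounds it by 4^m times the same integral at frequency 2^-m e. *)
have bound m : 4^-1 - fcos u e <= C m ^+ 2.
  apply: (@le_trans _ _ (4 ^+ m * (4^-1 - fcos u (2^-1 ^+ m *: e)))).
    rewrite -Iu -!RintegralB //; try exact: integrable_mulcos.
    rewrite -RintegralZl //; last first.
      exact: (integrableB measurableT iu (integrable_mulcos _ iu)).
    apply: le_Rintegral => //.
    - exact: (integrableB measurableT iu (integrable_mulcos _ iu)).
    - by have := integrableZl measurableT (4 ^+ m)
        (integrableB measurableT iu (integrable_mulcos (2^-1 ^+ m *: e) iu)).
    - move=> x _; rewrite rV_dotZl.
      have := ler_wpM2l (u0 x) (one_sub_cos_dyadic m (rV_dot e x)).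
      rewrite mulrBr mulr1 => /le_trans; apply.
      by rewrite le_eqVlt; apply/orP; left; apply/eqP; ring.
  have p4 : (2 ^+ m) ^+ 2 = 4 ^+ m :> R.
    by rewrite -exprM mulnC exprM; congr (_ ^+ m); ring.
  rewrite fu fcos_defect // /C exprMn p4; apply: ler_wpM2l; first exact: exprn_ge0.
  set a := fcos f _; set b := fsin f _.
  (* With a + ib the transform of [f], one has 1/4 - (a - a^2 + b^2) = (1/2 - a)^2 - b^2, so
     dropping b^2 leaves an upper bound. *)
  rewrite -subr_ge0 (_ : _ - _ = b ^+ 2) ?sqr_ge0 //; by field.
have C20 : C m ^+ 2 @[m --> \oo] --> (0 : R).
  by rewrite -(mulr0 0); under eq_fun do rewrite expr2; exact: cvgM.
have : 4^-1 - fcos u e <= 0.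
  by apply: (ler_cvg_to (cvg_cst _) C20); exact: nearW.
by rewrite subr_le0 leNgt lt.
Qed.

Unset Implicit Arguments.

Theorem theorem2 (R : realType) (d : nat) (hd : (1 <= d)%N)
    (f : 'rV[R]_d -> R)
    (hf : (@lebesgue_rV R d).-integrable [set: 'rV[R]_d] (EFin \o f))
    (hconv : {ae @lebesgue_rV R d, forall x, convolution f f x <= f x})
    (hint : \int[@lebesgue_rV R d]_x f x = 2^-1) :
  (\int[@lebesgue_rV R d]_x (eucl_norm x * f x)%:E)%E = +oo%E.
Proof.
apply: contrapT => /eqP Ifin.
have f0 := convolution_le_ge0 hf hconv hint.
have mf : measurable_fun setT f by apply/measurable_EFinP; exact: measurable_int hf.
have mef : measurable_fun setT (fun x => eucl_norm x * f x).
  by apply: measurable_funM => //; exact: measurable_eucl_norm.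
(* The hypothesis d >= 1 provides the coordinate 0, whose absolute value is at most the Euclidean
   norm. *)
pose i : 'I_d := Ordinal hd.
have mif : measurable_fun setT (fun x : 'rV[R]_d => x ord0 i * f x).
  by apply: measurable_funM => //; exact: measurable_rV_coord.
apply: (coord_first_moment_infinite (i := i) hf hconv hint).
apply/integrableP; split; first exact/measurable_EFinP.
have Ilt : (\int[@lebesgue_rV R d]_x (eucl_norm x * f x)%:E < +oo)%E by rewrite ltey.
apply: le_lt_trans Ilt.
(* Non-negativity of [f] almost everywhere turns the integral of |x| f into that of its absolute
   value, which dominates the one for x_i f. *)
rewrite [leRHS](_ : _ = \int[@lebesgue_rV R d]_x `|(eucl_norm x * f x)%:E|)%E.
  apply: ge0_le_integral => //.
  - by apply: measurableT_comp => //; exact/measurable_EFinP.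
  - by apply: measurableT_comp => //; exact/measurable_EFinP.
  - move=> x _; rewrite lee_fin !normrM ler_wpM2r //.
    by rewrite [leRHS]ger0_norm ?coord_le_eucl_norm // sqrtr_ge0.
apply: ae_eq_integral => //.
- exact/measurable_EFinP.
- by apply: measurableT_comp => //; exact/measurable_EFinP.
- apply: filterS f0 => x fx _.
  by rewrite abse_EFin ger0_norm // mulr_ge0 // sqrtr_ge0.
Qed.
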